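(* Let $k$ be a field and let $A$ be a DG $k$-algebra of finite type, with dual DG coalgebra $C=DA$. If $M$ and $N$ are locally finite left and right DG $A$-modules, respectively, then there is a natural isomorphism of DG vector spaces $$M\square_C N\;\cong\;\operatorname{Hom}_{A^e}(A,M\otimes N).$$
   Context: $\otimes=\otimes_k$; signs follow the usual Koszul convention. A DG algebra $A$ is a graded algebra $A^0\oplus A^1\oplus\cdots$ with a differential of degree $+1$ satisfying the Leibniz rule; finite type means each $A^n$ is finite-dimensional. DG $A$-modules have differentials of degree $+1$. A DG coalgebra is a non-negatively graded coalgebra with a differential of degree $-1$ satisfying the co-Leibniz rule; DG comodules have differentials of degree $-1$. Chain and cochain indexing are related by $V^n=V_{-n}$. The dual $C=DA$ has $C_n=\operatorname{Hom}_k(A^n,k)$. A module is locally finite if each element generates a finite-dimensional (graded) $A$-submodule. A locally finite left DG $A$-module $M$ is regarded as a right DG $C$-comodule, with the same differential, via $\Delta_M\colon M\to M\otimes DA\subset\operatorname{Hom}(A,M)$, $\Delta_M(m)(a)=am$; similarly for right modules and left comodules. $M\square_CN$ is the kernel of $\Delta_M\otimes1-1\otimes\Delta_N\colon M\otimes N\to M\otimes C\otimes N$, a DG vector subspace of $M\otimes N$. $A^e=A\otimes A^{\mathrm{op}}$; $M\otimes N$ is the DG $A$-bimodule with left action on $M$ and right action on $N$; $\operatorname{Hom}_{A^e}(A,B)$ is the DG vector space whose degree $p$ part consists of the degree $p$ maps of graded bimodules $A\to B$, with the usual Hom differential. *)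

(* Defs.v *)
From HB Require Import structures.
From mathcomp Require Import all_boot all_order all_algebra.
From mathcomp Require Import generic_quotient ring.
From mathcomp Require Import boolp classical_sets functions.

Set Implicit Arguments.
Unset Strict Implicit.
Unset Printing Implicit Defensive.

Import Order.TTheory GRing.Theory Num.Theory.
Local Open Scope ring_scope.
Local Open Scope quotient_scope.

Section LinearFacts.
Variable k : fieldType.
Implicit Types U V W : lmodType k.

Lemma lin0 U V (f : U -> V) : linear f -> f 0 = 0.
Proof.
by move=> h; apply: (@addrI _ (f 0)); have := h 1 0 0; rewrite !scale1r !addr0.
Qed.

Lemma linD U V (f : U -> V) : linear f -> {morph f : x y / x + y}.
Proof. by move=> h x y; have := h 1 x y; rewrite !scale1r. Qed.

Lemma linZ U V (f : U -> V) : linear f -> forall c x, f (c *: x) = c *: f x.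
Proof. by move=> h c x; have := h c x 0; rewrite !addr0 (lin0 h) addr0. Qed.

Lemma linN U V (f : U -> V) : linear f -> {morph f : x / - x}.
Proof. by move=> h x; rewrite -scaleN1r (linZ h) scaleN1r. Qed.

Lemma linB U V (f : U -> V) : linear f -> {morph f : x y / x - y}.
Proof. by move=> h x y; rewrite (linD h) (linN h). Qed.

Lemma lin_sum U V (f : U -> V) I (r : seq I) (F : I -> U) :
  linear f -> f (\sum_(i <- r) F i) = \sum_(i <- r) f (F i).
Proof.
move=> h; elim: r => [|i r IH]; first by rewrite !big_nil (lin0 h).
by rewrite !big_cons (linD h) IH.
Qed.

Lemma lin_mk U V (f : U -> V) : {morph f : x y / x + y} ->
  (forall c x, f (c *: x) = c *: f x) -> linear f.
Proof. by move=> hD hZ c x y; rewrite hD hZ. Qed.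

Lemma lin_comp U V W (f : V -> W) (g : U -> V) :
  linear f -> linear g -> linear (fun x => f (g x)).
Proof. by move=> hf hg c x y; rewrite hg hf. Qed.

Lemma lin_id U : linear (fun x : U => x).
Proof. by []. Qed.

Lemma lin_zero U V : linear (fun _ : U => 0 : V).
Proof. by move=> c x y; rewrite scaler0 addr0. Qed.

Lemma lin_add U V (f g : U -> V) :
  linear f -> linear g -> linear (fun x => f x + g x).
Proof. by move=> hf hg c x y; rewrite hf hg scalerDr addrACA. Qed.

Lemma lin_scale U V (c : k) (f : U -> V) : linear f -> linear (fun x => c *: f x).
Proof. by move=> hf a x y; rewrite hf scalerDr !scalerA mulrC. Qed.

Lemma lin_opp U V (f : U -> V) : linear f -> linear (fun x => - f x).
Proof. by move=> hf a x y; rewrite hf opprD scalerN. Qed.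

Lemma lin_bigsum U V I (r : seq I) (F : I -> U -> V) :
  (forall i, linear (F i)) -> linear (fun x => \sum_(i <- r) F i x).
Proof.
move=> h; elim: r => [|i r IH] c x y; first by rewrite !big_nil scaler0 addr0.
by rewrite !big_cons h IH scalerDr addrACA.
Qed.

Definition bilin U V W (b : U -> V -> W) :=
  (forall v, linear (b^~ v)) /\ (forall u, linear (b u)).

End LinearFacts.

Section TensorProduct.
Variables (k : fieldType) (V W : lmodType k).

(* V \ox W is built as formal sums (lists) of pairs (v, w), two sums being
   identified when no bilinear map distinguishes them; tensor_universal below is
   the usual universal property. *)
Definition tsum (U : lmodType k) (b : V -> W -> U) (s : seq (V * W)) : U :=
  \sum_(p <- s) b p.1 p.2.

Definition teqv (s t : seq (V * W)) : bool :=
  `[< forall (U : lmodType k) (b : V -> W -> U), bilin b -> tsum b s = tsum b t >].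

Lemma teqv_equiv : equivalence_rel teqv.
Proof.
move=> s t u; split; first by apply/asboolP.
move=> /asboolP st; apply/asboolP/asboolP => h U b hb; last by rewrite st ?h.
by rewrite -st ?h.
Qed.

Lemma teqv_refl : reflexive teqv.
Proof. by move=> s; apply/asboolP. Qed.
Lemma teqv_sym : symmetric teqv.
Proof. by move=> s t; apply/asboolP/asboolP => h U b /h. Qed.
Lemma teqv_trans : transitive teqv.
Proof.
by move=> s t u /asboolP h1 /asboolP h2; apply/asboolP => U b hb; rewrite h1 ?h2.
Qed.

Canonical teqv_equivRel := EquivRel teqv teqv_refl teqv_sym teqv_trans.

Definition tensor := {eq_quot teqv_equivRel}.
HB.instance Definition _ := Choice.on tensor.

Definition tlift (U : lmodType k) (b : V -> W -> U) (x : tensor) : U :=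
  tsum b (repr x).

Definition tclass (s : seq (V * W)) : tensor := \pi_({eq_quot teqv_equivRel}) s.

Definition ten (v : V) (w : W) : tensor := tclass [:: (v, w)].

Definition tadd (x y : tensor) : tensor := tclass (repr x ++ repr y).
Definition tscale (c : k) (x : tensor) : tensor :=
  tclass [seq (c *: p.1, p.2) | p <- repr x].
Definition topp (x : tensor) : tensor := tscale (-1) x.
Definition tzero : tensor := tclass [::].

Lemma tlift_class (U : lmodType k) (b : V -> W -> U) s :
  bilin b -> tlift b (tclass s) = tsum b s.
Proof.
move=> hb; rewrite /tlift.
have /eqmodP/asboolP h : repr (tclass s) = s %[mod tensor] by rewrite reprK.
exact: h.
Qed.

Lemma tlift_inj (x y : tensor) :
  (forall (U : lmodType k) (b : V -> W -> U), bilin b -> tlift b x = tlift b y) ->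
  x = y.
Proof.
by move=> h; rewrite -[x]reprK -[y]reprK; apply/eqmodP/asboolP => U b /h.
Qed.

Lemma tlift_add (U : lmodType k) (b : V -> W -> U) x y :
  bilin b -> tlift b (tadd x y) = tlift b x + tlift b y.
Proof. by move=> hb; rewrite tlift_class // /tsum big_cat. Qed.

Lemma tlift_scale (U : lmodType k) (b : V -> W -> U) c x :
  bilin b -> tlift b (tscale c x) = c *: tlift b x.
Proof.
move=> hb; rewrite tlift_class // /tsum big_map scaler_sumr.
by apply: eq_bigr => p _ /=; rewrite (linZ (hb.1 p.2)).
Qed.

Lemma tlift_zero (U : lmodType k) (b : V -> W -> U) :
  bilin b -> tlift b tzero = 0.
Proof. by move=> hb; rewrite tlift_class // /tsum big_nil. Qed.

Fact taddA : associative tadd.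
Proof. by move=> x y z; apply: tlift_inj => U b h; rewrite !tlift_add // addrA. Qed.
Fact taddC : commutative tadd.
Proof. by move=> x y; apply: tlift_inj => U b h; rewrite !tlift_add // addrC. Qed.
Fact tadd0 : left_id tzero tadd.
Proof. by move=> x; apply: tlift_inj => U b h; rewrite tlift_add // tlift_zero // add0r. Qed.
Fact taddN : left_inverse tzero topp tadd.
Proof.
move=> x; apply: tlift_inj => U b h.
by rewrite tlift_add // tlift_scale // tlift_zero // scaleN1r addNr.
Qed.
HB.instance Definition _ := GRing.isZmodule.Build tensor taddA taddC tadd0 taddN.

Fact tscaleA a b x : tscale a (tscale b x) = tscale (a * b) x.
Proof. by apply: tlift_inj => U f h; rewrite !tlift_scale // scalerA. Qed.
Fact tscale1 : left_id 1 tscale.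
Proof. by move=> x; apply: tlift_inj => U f h; rewrite !tlift_scale // scale1r. Qed.
Fact tscaleDr : right_distributive tscale +%R.
Proof.
move=> a x y; apply: tlift_inj => U f h.
by rewrite !(tlift_scale, tlift_add) // scalerDr.
Qed.
Fact tscaleDl x : {morph tscale^~ x : a b / a + b}.
Proof.
move=> a b; apply: tlift_inj => U f h.
by rewrite !(tlift_scale, tlift_add) // scalerDl.
Qed.
HB.instance Definition _ :=
  GRing.Zmodule_isLmodule.Build k tensor tscaleA tscale1 tscaleDr tscaleDl.

Lemma tlift_lin (U : lmodType k) (b : V -> W -> U) : bilin b -> linear (tlift b).
Proof. by move=> hb c x y; rewrite tlift_add // tlift_scale. Qed.

Lemma tliftE (U : lmodType k) (b : V -> W -> U) v w :
  bilin b -> tlift b (ten v w) = b v w.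
Proof. by move=> hb; rewrite tlift_class // /tsum big_seq1. Qed.

Lemma ten_bilin : bilin ten.
Proof.
split=> [w|v] c x y; apply: tlift_inj => U b hb;
  rewrite tlift_add // tlift_scale // !tliftE //.
- by rewrite (hb.1 w).
- by rewrite (hb.2 v).
Qed.

Lemma ten_sum (x : tensor) : x = \sum_(p <- repr x) ten p.1 p.2.
Proof.
apply: tlift_inj => U b hb.
rewrite (lin_sum _ _ (tlift_lin hb)).
by apply: eq_bigr => p _; rewrite tliftE.
Qed.

Lemma ten_ind (P : tensor -> Prop) :
  P 0 -> (forall x y, P x -> P y -> P (x + y)) -> (forall v w, P (ten v w)) ->
  forall x, P x.
Proof.
move=> h0 hD ht x; rewrite (ten_sum x).
by elim: (repr x) => [|p s IH]; rewrite ?big_nil ?big_cons //; apply: hD.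
Qed.

Lemma ten_ext (U : lmodType k) (f g : tensor -> U) :
  linear f -> linear g -> (forall v w, f (ten v w) = g (ten v w)) ->
  forall x, f x = g x.
Proof.
move=> hf hg h; apply: ten_ind => [|x y hx hy|//]; first by rewrite !lin0.
by rewrite (linD hf) (linD hg) hx hy.
Qed.

Theorem tensor_universal (U : lmodType k) (b : V -> W -> U) : bilin b ->
  exists! f : tensor -> U, linear f /\ forall v w, f (ten v w) = b v w.
Proof.
move=> hb; exists (tlift b); split=> [|g [hg hgb]].
  by split=> [|v w]; [exact: tlift_lin | exact: tliftE].
apply: funext => x; apply: ten_ext x => // [|v w]; first exact: tlift_lin.
by rewrite tliftE.
Qed.

End TensorProduct.

Arguments ten {k V W} v w.
Arguments tlift {k V W U} b x.

Section TensorMaps.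
Variable k : fieldType.
Implicit Types U V W X Y Z : lmodType k.

Definition tmap U V W X (f : U -> W) (g : V -> X) : tensor U V -> tensor W X :=
  tlift (fun u v => ten (f u) (g v)).

Lemma bilin_comp U V W X Y (b : W -> X -> Y) (f : U -> W) (g : V -> X) :
  bilin b -> linear f -> linear g -> bilin (fun u v => b (f u) (g v)).
Proof.
move=> [h1 h2] hf hg; split=> [v|u] c x y; first by rewrite hf h1.
by rewrite hg h2.
Qed.

Lemma tmap_bilin U V W X (f : U -> W) (g : V -> X) :
  linear f -> linear g -> bilin (fun u v => ten (f u) (g v)).
Proof. by move=> hf hg; apply: (bilin_comp (ten_bilin W X)). Qed.

Lemma tmap_lin U V W X (f : U -> W) (g : V -> X) :
  linear f -> linear g -> linear (tmap f g).
Proof. by move=> hf hg; apply/tlift_lin/tmap_bilin. Qed.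

Lemma tmapE U V W X (f : U -> W) (g : V -> X) u v :
  linear f -> linear g -> tmap f g (ten u v) = ten (f u) (g v).
Proof. by move=> hf hg; rewrite /tmap tliftE //; apply: tmap_bilin. Qed.

Lemma tmap_comp U V W X Y Z (f : U -> W) (g : V -> X) (f' : W -> Y) (g' : X -> Z) x :
  linear f -> linear g -> linear f' -> linear g' ->
  tmap f' g' (tmap f g x) = tmap (fun u => f' (f u)) (fun v => g' (g v)) x.
Proof.
move=> hf hg hf' hg'; move: x; apply: ten_ext.
- by apply: lin_comp; apply: tmap_lin.
- by apply: tmap_lin; apply: lin_comp.
- by move=> u v; rewrite !tmapE //; apply: lin_comp.
Qed.

Lemma tmap_id U V (x : tensor U V) : tmap id id x = x.
Proof. by move: x; apply: ten_ext => [||v w]; [exact: tmap_lin|by []|exact: tmapE]. Qed.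

Definition tassoc U V W : tensor (tensor U V) W -> tensor U (tensor V W) :=
  tlift (fun x w => tlift (fun u v => ten u (ten v w)) x).

Lemma ten_linl V W (w : W) : linear (fun v : V => ten v w).
Proof. exact: (ten_bilin V W).1. Qed.
Lemma ten_linr V W (v : V) : linear (fun w : W => ten v w).
Proof. exact: (ten_bilin V W).2. Qed.

Lemma tassoc_bilin1 U V W (w : W) : bilin (fun (u : U) (v : V) => ten u (ten v w)).
Proof. exact: (bilin_comp (ten_bilin _ _) (@lin_id _ _) (@ten_linl _ _ w)). Qed.

Lemma tassoc_bilin U V W :
  bilin (fun (x : tensor U V) (w : W) => tlift (fun u v => ten u (ten v w)) x).
Proof.
split=> [w|x]; first exact/tlift_lin/tassoc_bilin1.
move=> c w w'; move: x; apply: ten_ext.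
- exact/tlift_lin/tassoc_bilin1.
- by apply: lin_add; [apply: lin_scale|]; exact/tlift_lin/tassoc_bilin1.
- move=> u v; rewrite !tliftE; try exact: tassoc_bilin1.
  by rewrite (ten_linr v) (ten_linr u).
Qed.

Lemma tassoc_lin U V W : linear (@tassoc U V W).
Proof. exact/tlift_lin/tassoc_bilin. Qed.

Lemma tassocE U V W (u : U) (v : V) (w : W) :
  tassoc (ten (ten u v) w) = ten u (ten v w).
Proof. by rewrite /tassoc tliftE ?tliftE //; [exact: tassoc_bilin1|exact: tassoc_bilin]. Qed.

Lemma ten_ext3 U V W X (f g : tensor (tensor U V) W -> X) :
  linear f -> linear g ->
  (forall u v w, f (ten (ten u v) w) = g (ten (ten u v) w)) -> forall x, f x = g x.
Proof.
move=> hf hg h; apply: ten_ext => // x w; move: x; apply: ten_ext => //;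
  by apply: lin_comp => //; apply: ten_linl.
Qed.

Lemma ten_ext3r U V W X (f g : tensor U (tensor V W) -> X) :
  linear f -> linear g ->
  (forall u v w, f (ten u (ten v w)) = g (ten u (ten v w))) -> forall x, f x = g x.
Proof.
move=> hf hg h; apply: ten_ext => // u x; move: x; apply: ten_ext => //;
  by apply: lin_comp => //; apply: ten_linr.
Qed.

End TensorMaps.

Section Graded.
Variable k : fieldType.

(* A graded vector space V = \bigoplus_(n : int) V^n is an lmodType together with
   the projections pr n onto V^n, which determine the grading; V^n is
   {v | homog n v}. The grading is cohomological: a chain-graded object is
   V_n = V^(- n). *)
Record graded_axioms (V : lmodType k) (pr : int -> V -> V) : Prop := GradedAxioms {
  pr_lin : forall n, linear (pr n);
  pr_pr : forall m n v, pr m (pr n v) = if m == n then pr n v else 0;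
  pr_sum : forall v, exists s : seq int, uniq s /\ v = \sum_(n <- s) pr n v }.

Section Decomposition.
Variables (V : lmodType k) (pr : int -> V -> V).
Hypothesis lin : forall n, linear (pr n).
Hypothesis idem : forall m n v, pr m (pr n v) = if m == n then pr n v else 0.

Definition decomp s v := uniq s /\ v = \sum_(n <- s) pr n v.

Lemma decompP s v : decomp s v <-> (uniq s /\ v = \sum_(n <- s) pr n v) /\
                    forall n, n \notin s -> pr n v = 0.
Proof.
split=> [[us E]|[]//]; split=> // n nt.
rewrite E (lin_sum _ _ (lin n)) big1_seq // => i /andP[_ it].
by rewrite idem; case: eqP => // e; rewrite e it in nt.
Qed.

Lemma decomp_sub s t v : uniq t -> {subset s <= t} -> decomp s v -> decomp t v.
Proof.
move=> ut st /decompP[[us E] h]; split=> //.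
rewrite (bigID (mem s)) /= [X in _ + X]big1 ?addr0; last by move=> i /h.
rewrite {1}E -(big_filter _ (mem s) (fun n => pr n v)); apply: perm_big.
apply: uniq_perm; rewrite ?filter_uniq // => i.
by rewrite mem_filter inE; case: (boolP (i \in s)) => // /st ->.
Qed.

Lemma decomp_add s t v w :
  decomp s v -> decomp t w -> decomp (undup (s ++ t)) (v + w).
Proof.
move=> hs ht; have uu := undup_uniq (s ++ t); split=> //.
have [_ {1}->] : decomp (undup (s ++ t)) v.
  by apply: decomp_sub hs => // n; rewrite mem_undup mem_cat => ->.
have [_ {1}->] : decomp (undup (s ++ t)) w.
  by apply: decomp_sub ht => // n; rewrite mem_undup mem_cat => ->; rewrite orbT.
by rewrite -big_split; apply: eq_bigr => n _; rewrite (linD (lin n)).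
Qed.

End Decomposition.

Record gvect := GVect {
  gcar :> lmodType k;
  pr : int -> gcar -> gcar;
  gvectP : graded_axioms pr }.

Definition homog (V : gvect) (n : int) (v : V) := pr n v = v.

Section Theory.
Variable V : gvect.
Implicit Types (v w : V) (s : seq int).

Lemma prl n : linear (@pr V n). Proof. exact: pr_lin (gvectP V) n. Qed.
Lemma prpr m n v : pr m (pr n v) = if m == n then pr n v else 0.
Proof. exact: pr_pr (gvectP V) m n v. Qed.
Lemma homog_pr n v : homog n (pr n v).
Proof. by rewrite /homog prpr eqxx. Qed.
Lemma pr_homog m n v : homog n v -> pr m v = if m == n then v else 0.
Proof. by move=> <-; rewrite prpr. Qed.
Lemma homog_scale n c v : homog n v -> homog n (c *: v).
Proof. by rewrite /homog (linZ (prl n)) => ->. Qed.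
Lemma homog_add n v w : homog n v -> homog n w -> homog n (v + w).
Proof. by rewrite /homog (linD (prl n)) => -> ->. Qed.
Lemma homog0 n : homog n (0 : V).
Proof. exact: lin0 (prl n). Qed.

Definition covers s v := uniq s /\ forall n, n \notin s -> pr n v = 0.

Lemma sum_covers s v : decomp (@pr V) s v -> covers s v.
Proof. by move=> /(decompP prl prpr)[[us _] h]. Qed.

Lemma covers_sum s v : covers s v -> v = \sum_(n <- s) pr n v.
Proof.
move=> [us h]; have [t dt] := pr_sum (gvectP V) v.
have ut := undup_uniq (s ++ t).
have [_ E] : decomp (@pr V) (undup (s ++ t)) v.
  by apply: decomp_sub (dt) => //; [exact: prl|exact: prpr|move=> n; rewrite mem_undup mem_cat orbC => ->].
rewrite {1}E (bigID (mem s)) /= [X in _ + X]big1 ?addr0; last by move=> i /h.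
rewrite -(big_filter _ (mem s) (fun n => pr n v)); apply: perm_big.
apply: uniq_perm; rewrite ?filter_uniq // => i.
by rewrite mem_filter inE mem_undup mem_cat; case: (i \in s).
Qed.

Lemma covers_exists v : {s | covers s v}.
Proof.
by apply: cid; have [s /sum_covers h] := pr_sum (gvectP V) v; exists s.
Qed.

Definition supp v := sval (covers_exists v).
Lemma suppP v : covers (supp v) v. Proof. exact: svalP (covers_exists v). Qed.

Lemma covers_sub s t v : covers s v -> uniq t -> {subset s <= t} -> covers t v.
Proof. by move=> [_ h] ut st; split=> // n nt; apply: h; apply: contra nt => /st. Qed.

Lemma covers_add s t v w : covers s v -> covers t w -> covers (undup (s ++ t)) (v + w).
Proof.
move=> [_ h] [_ h']; split; first exact: undup_uniq.
move=> n; rewrite mem_undup mem_cat negb_or => /andP[ns nt].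
by rewrite (linD (prl n)) h // h' // addr0.
Qed.

Lemma covers_homog n v : homog n v -> covers [:: n] v.
Proof.
by move=> h; split=> // m; rewrite inE (pr_homog m h) => /negPf ->.
Qed.

Lemma gind (P : V -> Prop) :
  P 0 -> (forall v w, P v -> P w -> P (v + w)) ->
  (forall n v, homog n v -> P v) -> forall v, P v.
Proof.
move=> h0 hD hh v; rewrite (covers_sum (suppP v)).
elim: (supp v) => [|n s IH]; rewrite ?big_nil ?big_cons //.
by apply: hD => //; apply: (hh n); apply: homog_pr.
Qed.

Lemma gext (U : lmodType k) (f g : V -> U) : linear f -> linear g ->
  (forall n v, homog n v -> f v = g v) -> forall v, f v = g v.
Proof.
move=> hf hg h; apply: gind => [|v w hv hw|n v /h//]; first by rewrite !lin0.
by rewrite (linD hf) (linD hg) hv hw.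
Qed.

(* The linear map which is F n on V^n. *)
Definition glue (U : lmodType k) (F : int -> V -> U) (v : V) : U :=
  \sum_(n <- supp v) F n (pr n v).

Section Glue.
Variables (U : lmodType k) (F : int -> V -> U).
Hypothesis Flin : forall n, linear (F n).

Lemma glue_covers s v : covers s v -> glue F v = \sum_(n <- s) F n (pr n v).
Proof.
move=> cv; have [us h] := cv; have [ut H] := suppP v.
rewrite /glue (bigID (mem s)) /= [X in _ + X]big1 ?addr0; last first.
  by move=> i /h ->; rewrite lin0.
rewrite [RHS](bigID (mem (supp v))) /= [X in _ = _ + X]big1 ?addr0; last first.
  by move=> i /H ->; rewrite lin0.
rewrite -(big_filter _ (mem s)) -(big_filter _ (mem (supp v))); apply: perm_big.
apply: uniq_perm; rewrite ?filter_uniq // => i.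
by rewrite !mem_filter andbC.
Qed.

Lemma glue_lin : linear (glue F).
Proof.
move=> c v w; set s := undup (supp v ++ supp w).
have us : uniq s by apply: undup_uniq.
have cv : covers s v.
  by apply: covers_sub (suppP v) us _ => n; rewrite mem_undup mem_cat => ->.
have cw : covers s w.
  by apply: covers_sub (suppP w) us _ => n; rewrite mem_undup mem_cat => ->; rewrite orbT.
have cz : covers s (c *: v + w).
  split=> // n ns; rewrite (prl n) cv.2 // cw.2 // scaler0 addr0 //.
rewrite !(@glue_covers s) // scaler_sumr -big_split /=; apply: eq_bigr => n _.
by rewrite (prl n) Flin.
Qed.

Lemma glueE n v : homog n v -> glue F v = F n v.
Proof. by move=> h; rewrite (glue_covers (covers_homog h)) big_seq1 h. Qed.

End Glue.
End Theory.

(* v |-> (-1) ^ (m |v|) v, the Koszul sign of moving something of degree m past v. *)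
Definition ksign (V : gvect) (m : int) : V -> V :=
  glue (fun n v => (-1) ^ (m * n) *: v).

Lemma sgl (V : gvect) (c : k) : linear (fun v : V => c *: v).
Proof. by apply: lin_scale. Qed.

Lemma ksign_lin (V : gvect) m : linear (@ksign V m).
Proof. by apply: glue_lin => n; apply: sgl. Qed.

Lemma ksignE (V : gvect) m n (v : V) : homog n v -> ksign m v = (-1) ^ (m * n) *: v.
Proof. by move=> h; rewrite /ksign (glueE _ h) // => i; apply: sgl. Qed.

Lemma homog_ksign (V : gvect) m n (v : V) : homog n v -> homog n (ksign m v).
Proof. by move=> h; rewrite (ksignE _ h); apply: homog_scale. Qed.

Lemma pr_ksign (V : gvect) m n (v : V) : pr n (ksign m v) = ksign m (pr n v).
Proof.
move: v; apply: gext => [||j v h].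
- by apply: lin_comp; [apply: prl|apply: ksign_lin].
- by apply: lin_comp; [apply: ksign_lin|apply: prl].
rewrite (ksignE _ h) (linZ (prl n)) (pr_homog n h); case: eqP => _.
  by rewrite (ksignE _ h).
by rewrite scaler0 (lin0 (@ksign_lin V m)).
Qed.

End Graded.
Arguments pr {k V} n v : rename.
Arguments homog {k V} n v.
Arguments ksign {k V} m v.
Arguments glue {k V U} F v.
Arguments prl {k V} n.

Section Sign.
Variable k : fieldType.
Lemma sign_eq (c m n : int) : m = n + c *+ 2 -> (-1) ^ m = (-1) ^ n :> k.
Proof.
have h : (-1 : k) != 0 by rewrite oppr_eq0 oner_eq0.
by move=> ->; rewrite mulr2n !expfzDr // -expfzMl mulrNN mulr1 exp1rz mulr1.
Qed.
Lemma signD (m n : int) : (-1) ^ (m + n) = (-1) ^ m * (-1) ^ n :> k.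
Proof. by rewrite expfzDr // oppr_eq0 oner_eq0. Qed.
Lemma sign1 : (-1) ^ (1 : int) = -1 :> k. Proof. by []. Qed.
End Sign.

Section TensorGrading.
Variables (k : fieldType) (V W : gvect k).

(* (V \ox W)^p = \bigoplus_i V^i \ox W^(p - i) *)
Definition tpr (p : int) : tensor V W -> tensor V W :=
  tlift (fun v w => glue (fun i v' => ten v' (pr (p - i) w)) v).

Lemma tpr_bilin p : bilin (fun v w => glue (fun i v' => ten v' (pr (p - i) w)) v : tensor V W).
Proof.
have h (w : W) i : linear (fun v' : V => ten v' (pr (p - i) w)) by apply: ten_linl.
split=> [w|v]; first exact: glue_lin (h w).
move=> c w w'; move: v; apply: gext.
- exact: glue_lin (h _).
- by apply: lin_add; [apply: lin_scale|]; exact: glue_lin (h _).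
- by move=> n v hv; rewrite !(glueE (h _) hv) (prl (p - n)) (ten_linr v).
Qed.

Lemma tpr_lin p : linear (tpr p).
Proof. exact/tlift_lin/tpr_bilin. Qed.

Lemma tprE p i j (v : V) (w : W) : homog i v -> homog j w ->
  tpr p (ten v w) = if p == i + j then ten v w else 0.
Proof.
move=> hv hw; rewrite /tpr tliftE; last exact: tpr_bilin.
rewrite (glueE _ hv); last by move=> n; apply: ten_linl.
rewrite (pr_homog _ hw) subr_eq [j + i]addrC.
by case: eqP => // _; rewrite (lin0 (ten_linr v)).
Qed.

Lemma tgind (P : tensor V W -> Prop) :
  P 0 -> (forall x y, P x -> P y -> P (x + y)) ->
  (forall i j v w, homog i v -> homog j w -> P (ten v w)) -> forall x, P x.
Proof.
move=> h0 hD hh; apply: ten_ind => // v w; move: v; apply: gind => [|v v' hv hv'|i v hv].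
- by rewrite (lin0 (ten_linl w)).
- by rewrite (linD (ten_linl w)); apply: hD.
move: w; apply: gind => [|w w' hw hw'|j w hw].
- by rewrite (lin0 (ten_linr v)).
- by rewrite (linD (ten_linr v)); apply: hD.
exact: hh hv hw.
Qed.

Lemma tgext (U : lmodType k) (f g : tensor V W -> U) : linear f -> linear g ->
  (forall i j v w, homog i v -> homog j w -> f (ten v w) = g (ten v w)) ->
  forall x, f x = g x.
Proof.
move=> hf hg h; apply: tgind => [|x y hx hy|//]; first by rewrite !lin0.
by rewrite (linD hf) (linD hg) hx hy.
Qed.

Lemma tpr_idem m n x : tpr m (tpr n x) = if m == n then tpr n x else 0.
Proof.
move: x; apply: tgext.
- by apply: lin_comp; apply: tpr_lin.
- by case: (m == n); [apply: tpr_lin|apply: lin_zero].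
move=> i j v w hv hw; rewrite !(tprE _ hv hw).
case: (n =P i + j) => [->|_]; first by rewrite (tprE _ hv hw).
by rewrite (lin0 (tpr_lin m)); case: eqP.
Qed.

Lemma tensor_graded : graded_axioms tpr.
Proof.
split; first exact: tpr_lin.
- exact: tpr_idem.
- move=> x; suff: exists s, decomp tpr s x by [].
  elim/tgind: x => [|x y [s hs] [t ht]|i j v w hv hw].
  + by exists [::]; split; rewrite ?big_nil.
  + exists (undup (s ++ t)).
    by apply: decomp_add => //; [exact: tpr_lin|exact: tpr_idem].
  + by exists [:: i + j]; split; rewrite // big_seq1 (tprE _ hv hw) eqxx.
Qed.

End TensorGrading.

Section Subspace.
Variables (k : fieldType) (V : lmodType k) (P : V -> Prop).

Definition subspace := P 0 /\ forall c u v, P u -> P v -> P (c *: u + v).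

Definition subpred (hP : subspace) : {pred V} := fun v => `[< P v >].

Lemma subpred_closed hP : submod_closed (subpred hP).
Proof.
case: (hP) => h0 hD; split=> [|c u v /asboolP hu /asboolP hv]; apply/asboolP => //.
exact: hD.
Qed.
HB.instance Definition _ hP :=
  GRing.isSubmodClosed.Build k V (subpred hP) (subpred_closed hP).

Record subt (hP : subspace) := SubT { incl : V; inclP : incl \in subpred hP }.
HB.instance Definition _ hP := [isSub for @incl hP].
HB.instance Definition _ hP := [Choice of subt hP by <:].
HB.instance Definition _ hP := [SubChoice_isSubLmodule of subt hP by <:].

Definition mksub hP v (hv : P v) : subt hP := SubT (introT (asboolP (P v)) hv).

Lemma inclE hP (x : subt hP) : P (incl x).
Proof. exact: asboolW (inclP x). Qed.

Lemma incl_lin hP : linear (@incl hP).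
Proof. by move=> c x y; rewrite -[LHS]/(val _) linearP. Qed.

Lemma incl_inj hP : injective (@incl hP).
Proof. exact: val_inj. Qed.

Lemma subspace_add : subspace -> forall u v, P u -> P v -> P (u + v).
Proof. by move=> [_ h] u v hu hv; rewrite -[u]scale1r; apply: h. Qed.
Lemma subspace_scale : subspace -> forall c v, P v -> P (c *: v).
Proof. by move=> [h0 h] c v hv; rewrite -[_ *: _]addr0; apply: h. Qed.
Lemma subspace_sum I (r : seq I) (F : I -> V) : subspace ->
  (forall i, P (F i)) -> P (\sum_(i <- r) F i).
Proof.
move=> hP hF; elim: r => [|i r IH]; first by rewrite big_nil; case: hP.
by rewrite big_cons; apply: subspace_add.
Qed.

End Subspace.

Section DGVect.
Variable k : fieldType.

Record dg_axioms (V : gvect k) (d : V -> V) : Prop := DGAxioms {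
  d_lin : linear d;
  d_deg : forall n v, homog n v -> homog (n + 1) (d v);
  d_sq : forall v, d (d v) = 0 }.

Record dgvect := DGVect {
  dg_gr :> gvect k;
  dif : dg_gr -> dg_gr;
  dgvectP : dg_axioms dif }.

Record dgmor (V W : dgvect) (f : V -> W) : Prop := DGMor {
  dgmor_lin : linear f;
  dgmor_pr : forall n v, f (pr n v) = pr n (f v);
  dgmor_d : forall v, f (dif v) = dif (f v) }.

Definition dgiso (V W : dgvect) (f : V -> W) := dgmor f /\ bijective f.

Lemma difl (V : dgvect) : linear (@dif V).
Proof. exact: d_lin (dgvectP V). Qed.
Lemma dif_homog (V : dgvect) n (v : V) : homog n v -> homog (n + 1) (dif v).
Proof. exact: (d_deg (dgvectP V)). Qed.
Lemma dif_dif (V : dgvect) (v : V) : dif (dif v) = 0.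
Proof. exact: (d_sq (dgvectP V)). Qed.
Lemma dif_pr (V : dgvect) n (v : V) : dif (pr n v) = pr (n + 1) (dif v).
Proof.
move: v; apply: gext => [||i v hv].
- exact: lin_comp (@difl V) (prl n).
- exact: lin_comp (prl (n + 1)) (@difl V).
rewrite (pr_homog _ hv) (pr_homog _ (dif_homog hv)) (inj_eq (@addIr _ 1)).
by case: eqP; rewrite ?(lin0 (@difl V)).
Qed.
Lemma dif_ksign (V : dgvect) m (v : V) : dif (ksign m v) = (-1) ^ m *: ksign m (dif v).
Proof.
move: v; apply: gext => [||i v hv].
- exact: lin_comp (@difl V) (@ksign_lin _ _ m).
- by apply: lin_scale; exact: lin_comp (@ksign_lin _ _ m) (@difl V).
rewrite (ksignE _ hv) (ksignE _ (dif_homog hv)) (linZ (@difl V)) scalerA -signD.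
by congr (_ *: _); apply: (@sign_eq _ (- m)); ring.
Qed.

Lemma dgmor_homog (V W : dgvect) (f : V -> W) n v : dgmor f -> homog n v -> homog n (f v).
Proof. by move=> hf hv; rewrite /homog -(dgmor_pr hf) hv. Qed.
Lemma dgmor_ksign (V W : dgvect) (f : V -> W) m v : dgmor f -> f (ksign m v) = ksign m (f v).
Proof.
move=> hf; have fl := dgmor_lin hf; move: v; apply: gext => [||i v hv].
- exact: lin_comp fl (@ksign_lin _ _ m).
- exact: lin_comp (@ksign_lin _ _ m) fl.
by rewrite (ksignE _ hv) (linZ fl) (ksignE _ (dgmor_homog hf hv)).
Qed.

Lemma dgmor_ext (V W : dgvect) (f : V -> W) : linear f ->
  (forall n v, homog n v -> homog n (f v)) -> (forall n v, homog n v -> f (dif v) = dif (f v)) ->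
  dgmor f.
Proof.
move=> fl fh fd; split=> // [n v|v]; move: v; apply: gext => //.
- exact: lin_comp fl (prl n).
- exact: lin_comp (prl n) fl.
- move=> i v hv; rewrite (pr_homog n hv) (pr_homog n (fh _ _ hv)).
  by case: eqP; rewrite ?(lin0 fl).
- exact: lin_comp fl (@difl V).
- exact: lin_comp (@difl W) fl.
Qed.

Lemma dgmor_id (V : dgvect) : dgmor (fun v : V => v).
Proof. by []. Qed.

Record dgsubspace (V : dgvect) (P : V -> Prop) : Prop := DGSubspace {
  dgs_sub : subspace P;
  dgs_pr : forall n v, P v -> P (pr n v);
  dgs_d : forall v, P v -> P (dif v) }.

Section SubDG.
Variables (V : dgvect) (P : V -> Prop) (hP : dgsubspace P).
Local Notation S := (subt (dgs_sub hP)).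

Definition sub_pr n (x : S) : S := mksub _ (dgs_pr hP n (inclE x)).
Definition sub_dif (x : S) : S := mksub _ (dgs_d hP (inclE x)).

Lemma incl_sum I (r : seq I) (F : I -> S) :
  incl (\sum_(i <- r) F i) = \sum_(i <- r) incl (F i).
Proof. exact: lin_sum (@incl_lin _ _ _ _). Qed.

Lemma sub_graded : graded_axioms sub_pr.
Proof.
split=> [n c x y|m n x|x]; first by apply: incl_inj; rewrite incl_lin /= (prl n).
  by apply: (@incl_inj _ _ _ (dgs_sub hP)); rewrite /= prpr; case: eqP.
have [s [us E]] := pr_sum (gvectP V) (incl x); exists s; split=> //.
by apply: incl_inj; rewrite incl_sum.
Qed.
Definition sub_gvect := GVect sub_graded.

Lemma sub_dgP : @dg_axioms sub_gvect sub_dif.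
Proof.
split=> [c x y|n x /(congr1 (@incl _ _ _ _)) hx|x]; apply: incl_inj.
- by rewrite incl_lin /= difl.
- exact: dif_homog.
- by rewrite /= dif_dif.
Qed.
Definition sub_dg : dgvect := DGVect sub_dgP.

End SubDG.

(* k concentrated in degree 0. *)
Definition unit_pr (n : int) (x : k^o) : k^o := if n == 0 then x else 0.
Lemma unit_graded : graded_axioms unit_pr.
Proof.
rewrite /unit_pr; split=> [n c x y|m n x|x]; first by case: ifP; rewrite // scaler0 addr0.
  have [->|mn] := eqVneq m n; first by case: (n == 0).
  have [n0|_] := eqVneq n 0; last by case: (m == 0).
  by rewrite n0 in mn; rewrite (negPf mn).
by exists [:: 0]; rewrite big_seq1 eqxx.
Qed.
Definition unit_gvect := GVect unit_graded.
Lemma unit_dgP : @dg_axioms unit_gvect (fun _ => 0).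
Proof. by split=> [|n v _|//]; [exact: lin_zero|exact: homog0]. Qed.
Definition unit_dg : dgvect := DGVect unit_dgP.

End DGVect.
Arguments dif {k V} v : rename.
Arguments difl {k V}.
Arguments ksign_lin {k V} m.

Section TensorDG.
Variable k : fieldType.

Section Def.
Variables V W : dgvect k.

Definition tensor_gr : gvect k := GVect (tensor_graded V W).

Lemma homog_ten i j (v : V) (w : W) :
  homog i v -> homog j w -> @homog _ tensor_gr (i + j) (ten v w).
Proof. by move=> hv hw; rewrite /homog /= (tprE _ hv hw) eqxx. Qed.

(* d (v \ox w) = d v \ox w + (-1)^|v| v \ox d w, see tdifE *)
Definition tdif : tensor_gr -> tensor_gr :=
  tlift (fun v w => ten (dif v) w + ten (ksign 1 v) (dif w)).

Lemma bilin_add (U X Y : lmodType k) (f g : U -> X -> Y) :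
  bilin f -> bilin g -> bilin (fun u v => f u v + g u v).
Proof. by move=> [f1 f2] [g1 g2]; split=> x; apply: lin_add. Qed.

Lemma bilin_scale (U X Y : lmodType k) (c : k) (f : U -> X -> Y) :
  bilin f -> bilin (fun u v => c *: f u v).
Proof. by move=> [f1 f2]; split=> x; apply: lin_scale. Qed.

Lemma tdif_bilin : bilin (fun (v : V) (w : W) => ten (dif v) w + ten (ksign 1 v) (dif w)).
Proof.
apply: bilin_add; apply: tmap_bilin => //; first exact: difl.
- exact: ksign_lin.
- exact: difl.
Qed.

Lemma tdif_lin : linear tdif.
Proof. exact/tlift_lin/tdif_bilin. Qed.

Lemma tdif_ten (v : V) (w : W) : tdif (ten v w) = ten (dif v) w + ten (ksign 1 v) (dif w).
Proof. by rewrite /tdif tliftE //; exact: tdif_bilin. Qed.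

Lemma tdifE i (v : V) (w : W) : homog i v ->
  tdif (ten v w) = ten (dif v) w + (-1) ^ i *: ten v (dif w).
Proof. by move=> hv; rewrite tdif_ten (ksignE _ hv) mul1r (linZ (ten_linl _)). Qed.

Lemma tensor_dgP : dg_axioms tdif.
Proof.
split; first exact: tdif_lin.
- move=> n x hx; suff E : tdif (pr n x) = pr (n + 1) (tdif x).
    by rewrite /homog -E hx.
  move: x {hx}; apply: tgext.
  + by apply: lin_comp; [exact: tdif_lin|exact: (@prl _ tensor_gr)].
  + by apply: lin_comp; [exact: (@prl _ tensor_gr)|exact: tdif_lin].
  move=> i j v w hv hw; rewrite /= (tdifE _ hv).
  rewrite (linD (tpr_lin _)) (linZ (tpr_lin _)) (tprE _ hv hw).
  rewrite (tprE _ (dif_homog hv) hw) (tprE _ hv (dif_homog hw)).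
  rewrite addrAC addrA !(inj_eq (@addIr _ 1)); case: eqP => _; first by rewrite (tdifE _ hv).
  by rewrite (lin0 tdif_lin) scaler0 addr0.
- apply: tgext => [||i j v w hv hw].
  + exact: lin_comp tdif_lin tdif_lin.
  + exact: lin_zero.
  rewrite (tdifE _ hv) (linD tdif_lin) (linZ tdif_lin) (tdifE _ (dif_homog hv)) (tdifE _ hv).
  rewrite !dif_dif (lin0 (ten_linl _)) (lin0 (ten_linr _)) scaler0 addr0 add0r.
  by rewrite signD sign1 mulrN1 scaleNr addNr.
Qed.
Definition tensor_dg : dgvect k := DGVect tensor_dgP.

End Def.

Lemma tmap_dg (V W X Y : dgvect k) (f : V -> X) (g : W -> Y) :
  dgmor f -> dgmor g -> @dgmor _ (tensor_dg V W) (tensor_dg X Y) (tmap f g).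
Proof.
move=> hf hg; have fl := dgmor_lin hf; have gl := dgmor_lin hg.
have tl : linear (tmap f g) by apply: tmap_lin.
split=> // [n|]; apply: tgext.
- exact: lin_comp tl (tpr_lin n).
- exact: lin_comp (tpr_lin n) tl.
- move=> i j v w hv hw /=; rewrite tmapE // (tprE _ hv hw).
  rewrite (tprE _ (dgmor_homog hf hv) (dgmor_homog hg hw)).
  by case: eqP => _; rewrite ?tmapE // (lin0 tl).
- exact: lin_comp tl (@tdif_lin _ _).
- exact: lin_comp (@tdif_lin _ _) tl.
- move=> i j v w hv hw /=; rewrite (tdifE _ hv) tmapE // (tdifE _ (dgmor_homog hf hv)).
  by rewrite (linD tl) (linZ tl) !tmapE // (dgmor_d hf) (dgmor_d hg).
Qed.

Lemma tgext3 (V W X : dgvect k) (U : lmodType k) (f g : tensor (tensor_dg V W) X -> U) :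
  linear f -> linear g ->
  (forall i j l v w x, homog i v -> homog j w -> homog l x ->
    f (ten (ten v w) x) = g (ten (ten v w) x)) -> forall x, f x = g x.
Proof.
move=> fl gl h; apply: ten_ext => // x w; move: w; apply: gext.
- by apply: lin_comp => //; apply: ten_linr.
- by apply: lin_comp => //; apply: ten_linr.
move=> l w hw; move: x; apply: tgext.
- by apply: lin_comp => //; apply: ten_linl.
- by apply: lin_comp => //; apply: ten_linl.
by move=> i j v x hv hx; apply: h hv hx hw.
Qed.

Lemma tassoc_dg (V W X : dgvect k) :
  @dgmor _ (tensor_dg (tensor_dg V W) X) (tensor_dg V (tensor_dg W X)) (@tassoc _ V W X).
Proof.
have al := @tassoc_lin _ V W X.
split=> // [n|]; apply: tgext3.
- by apply: lin_comp; [exact: al|exact: (@prl _ (tensor_dg (tensor_dg V W) X) n)].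
- by apply: lin_comp; [exact: (@prl _ (tensor_dg V (tensor_dg W X)) n)|exact: al].
- move=> i j l v w x hv hw hx /=; rewrite tassocE.
  rewrite (tprE _ (homog_ten hv hw) hx) (tprE _ hv (homog_ten hw hx)) addrA.
  by case: eqP; rewrite ?tassocE // (lin0 al).
- by apply: lin_comp; [exact: al|exact: (@difl _ (tensor_dg (tensor_dg V W) X))].
- by apply: lin_comp; [exact: (@difl _ (tensor_dg V (tensor_dg W X)))|exact: al].
- move=> i j l v w x hv hw hx /=; rewrite tassocE.
  rewrite (@tdifE (tensor_dg V W) X _ _ _ (homog_ten hv hw)).
  rewrite (@tdifE V (tensor_dg W X) _ _ _ hv) /= (tdifE _ hv) (tdifE _ hw).
  rewrite (linD al) (linZ al) (linD (ten_linl _)) (linZ (ten_linl _)) (linD al) (linZ al).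
  rewrite !tassocE (linD (ten_linr v)) (linZ (ten_linr v)) scalerDr scalerA -signD.
  by rewrite addrA.
Qed.

End TensorDG.

Section HomDG.
Variable k : fieldType.
Variables A B : dgvect k.

(* Hom(A, B) = \bigoplus_p Hom^p(A, B), where Hom^p(A, B) is the space of linear
   maps sending each A^i to B^(i + p) (hom_homogP below): a linear map belongs
   to the direct sum iff it has finitely many nonzero homogeneous components. *)
Definition gradedhom (f : A -> B) :=
  linear f /\
  exists s : seq int, forall p i a, p \notin s -> homog i a -> pr (i + p) (f a) = 0.

Lemma gradedhom_subspace : subspace gradedhom.
Proof.
split=> [|c f g [fl [s hs]] [gl [t ht]]].
  by split; [exact: lin_zero|exists [::] => p i a _ _; rewrite (lin0 (prl _))].
split; first by apply: lin_add => //; apply: lin_scale.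
exists (s ++ t) => p i a; rewrite mem_cat negb_or => /andP[ps pt] ha.
by rewrite (prl (i + p)) (hs p i a) // (ht p i a) // scaler0 addr0.
Qed.

Definition hom := subt gradedhom_subspace.
Implicit Type f : hom.

Lemma hom_lin f : linear (incl f).
Proof. by case: (inclE f). Qed.

Definition comp_fun (p : int) (f : A -> B) : A -> B :=
  glue (fun i a => pr (i + p) (f a)).

Lemma comp_lin p (f : A -> B) : linear f -> linear (comp_fun p f).
Proof. by move=> fl; apply: glue_lin => i; apply: lin_comp fl; apply: prl. Qed.

Lemma comp_funE p (f : A -> B) i a : linear f -> homog i a -> comp_fun p f a = pr (i + p) (f a).
Proof. by move=> fl ha; rewrite /comp_fun (glueE _ ha) // => j; apply: lin_comp fl; apply: prl. Qed.

Lemma comp_gradedhom p f : gradedhom (comp_fun p (incl f)).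
Proof.
have fl := hom_lin f; split; first exact: comp_lin.
exists [:: p] => q i a; rewrite inE => /negPf qp ha.
by rewrite (comp_funE _ fl ha) prpr (inj_eq (@addrI _ i)) qp.
Qed.

Definition hom_pr p f : hom := mksub _ (comp_gradedhom p f).

(* On maps f of degree p this is d f - (-1)^p f d, see hom_difE. *)
Definition dif_fun (f : A -> B) : A -> B := fun a => dif (f a) - ksign 1 (f (ksign 1 (dif a))).

Lemma dif_fun_lin (f : A -> B) : linear f -> linear (dif_fun f).
Proof.
move=> fl; apply: lin_add; first exact: lin_comp difl fl.
apply: lin_opp; apply: lin_comp; first exact: ksign_lin.
by apply: (lin_comp fl); apply: lin_comp; [exact: ksign_lin|exact: difl].
Qed.

Lemma pr_dif (V : dgvect k) n (v : V) : pr n (dif v) = dif (pr (n - 1) v).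
Proof. by rewrite dif_pr subrK. Qed.

Lemma dif_gradedhom f : gradedhom (dif_fun (incl f)).
Proof.
have [fl [s hs]] := inclE f; split; first exact: dif_fun_lin.
exists [seq p + 1 | p <- s] => p i a ps ha.
have {}ps : p - 1 \notin s.
  by apply: contra ps => h; apply/mapP; exists (p - 1); rewrite // subrK.
rewrite (linB (prl _)) pr_ksign pr_dif -addrA (hs _ _ _ ps ha) (lin0 difl) sub0r.
rewrite (ksignE _ (dif_homog ha)) (linZ fl) (linZ (prl _)).
have -> : i + p = i + 1 + (p - 1) by ring.
by rewrite (hs _ _ _ ps (dif_homog ha)) scaler0 (lin0 (ksign_lin 1)) oppr0.
Qed.

Definition hom_dif f : hom := mksub _ (dif_gradedhom f).

Lemma hom_eq f g : (forall i a, homog i a -> incl f a = incl g a) -> f = g.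
Proof. by move=> h; apply/incl_inj/funext; apply: gext => //; apply: hom_lin. Qed.

Lemma hom_sumE I (r : seq I) (F : I -> hom) a :
  incl (\sum_(i <- r) F i) a = \sum_(i <- r) incl (F i) a.
Proof.
elim: r => [|i r IH]; first by rewrite !big_nil (lin0 (@incl_lin _ _ _ _)).
by rewrite !big_cons (linD (@incl_lin _ _ _ _)) -IH.
Qed.

Lemma hom_combE c f g a : incl (c *: f + g) a = c *: incl f a + incl g a.
Proof. by rewrite incl_lin. Qed.

Lemma hom_graded : graded_axioms hom_pr.
Proof.
split=> [p c f g|p q f|f].
- apply: hom_eq => i a ha; rewrite hom_combE /=.
  rewrite !(@comp_funE p _ i a) //; try exact: hom_lin.
    exact: (prl (i + p)).
  exact: (hom_lin (c *: f + g)).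
- apply: hom_eq => i a ha; rewrite /= (comp_funE _ (comp_lin _ (hom_lin f)) ha).
  rewrite (comp_funE _ (hom_lin f) ha) prpr (inj_eq (@addrI _ i)).
  by case: eqP => _ /=; rewrite ?(comp_funE _ (hom_lin f) ha) ?(lin0 (@incl_lin _ _ _ _)).
have [fl [s hs]] := inclE f.
exists (undup s); split; first exact: undup_uniq.
apply: hom_eq => i a ha; rewrite hom_sumE.
transitivity (\sum_(p <- undup s) pr (i + p) (incl f a)); last first.
  by apply: eq_bigr => p _; rewrite /= (comp_funE _ fl ha).
rewrite -(big_map (fun p => i + p) xpredT (fun n => pr n (incl f a))).
apply: covers_sum; split; first by rewrite map_inj_uniq ?undup_uniq //; apply: addrI.
move=> n nn; have -> : n = i + (n - i) by ring.
apply: hs ha; apply: contra nn => h; apply/mapP; exists (n - i); last by ring.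
by rewrite mem_undup.
Qed.

Definition hom_gr : gvect k := GVect hom_graded.

Lemma hom_homogP p (f : hom_gr) :
  homog p f <-> forall i a, homog i a -> homog (i + p) (incl f a).
Proof.
split=> [<- i a ha|h].
  by rewrite /= (comp_funE _ (hom_lin f) ha); apply: homog_pr.
by apply: hom_eq => i a ha; rewrite /= (comp_funE _ (hom_lin f) ha) h.
Qed.

Lemma hom_difE p (f : hom_gr) a : homog p f ->
  incl (hom_dif f) a = dif (incl f a) - (-1) ^ p *: incl f (dif a).
Proof.
move=> hf; have fl := hom_lin f; rewrite /= /dif_fun; congr (_ - _).
move: a; apply: gext => [||i a ha].
- apply: lin_comp; first exact: ksign_lin.
  by apply: (lin_comp fl); apply: lin_comp; [exact: ksign_lin|exact: difl].
- by apply: lin_scale; exact: lin_comp fl difl.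
rewrite (ksignE _ (dif_homog ha)) (linZ fl) (linZ (ksign_lin 1)).
rewrite (ksignE _ ((hom_homogP p f).1 hf _ _ (dif_homog ha))) scalerA -signD.
by congr (_ *: _); apply: (@sign_eq _ (i + 1)); ring.
Qed.

Lemma hom_dgP : @dg_axioms _ hom_gr hom_dif.
Proof.
split.
- move=> c f g; apply: hom_eq => i a ha.
  have E h : incl (hom_dif h) a = dif (incl h a) - ksign 1 (incl h (ksign 1 (dif a))) by [].
  rewrite hom_combE !E !hom_combE.
  rewrite (ksign_lin 1) difl scalerBr opprD !addrA; congr (_ - _).
  by rewrite addrAC.
- move=> p f hf; apply/hom_homogP => i a ha; have hp := (hom_homogP p f).1 hf.
  rewrite (hom_difE _ hf); rewrite /homog (linB (prl _)) (linZ (prl _)).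
  have h1 := dif_homog (hp _ _ ha); have h2 := hp _ _ (dif_homog ha).
  have e : i + 1 + p = i + p + 1 by ring.
  by rewrite e in h2; rewrite addrA h1 h2.
- move=> f; apply: hom_eq => i a ha /=; have fl := hom_lin f.
  have E : dif_fun (incl f) (ksign 1 (dif a)) = dif (incl f (ksign 1 (dif a))).
    rewrite /dif_fun dif_ksign dif_dif (lin0 (ksign_lin 1)) scaler0.
    by rewrite (lin0 (ksign_lin 1)) (lin0 fl) (lin0 (ksign_lin 1)) subr0.
  rewrite {1}/dif_fun E /dif_fun (linB difl) dif_dif sub0r dif_ksign.
  by rewrite sign1 scaleN1r opprK subrr.
Qed.

Definition hom_dg : dgvect k := DGVect hom_dgP.

End HomDG.
Arguments hom_eq {k A B f g}.
Arguments comp_fun {k A B} p f a.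

Section Algebra.
Variable k : fieldType.

Definition finite_dim (V : lmodType k) (P : V -> Prop) :=
  exists s : seq V, forall v, P v ->
    exists c : nat -> k, v = \sum_(i < size s) c i *: s`_i.

(* The algebra may be zero, so the carrier is not an algType of the library, whose
   rings are nonzero. *)
Record dgalg_axioms (A : dgvect k) (mul : A -> A -> A) (one : A) : Prop := DGAlgAxioms {
  mul_bilin : bilin mul;
  mul_assoc : associative mul;
  mul_1l : left_id one mul;
  mul_1r : right_id one mul;
  one_deg : homog 0 one;
  mul_deg : forall i j a b, homog i a -> homog j b -> homog (i + j) (mul a b);
  mul_leibniz : forall i a b, homog i a ->
    dif (mul a b) = mul (dif a) b + (-1) ^ i *: mul a (dif b);
  alg_nonneg : forall n (a : A), n < 0 -> homog n a -> a = 0 }.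

Record dgalg := DGAlg {
  alg_dg :> dgvect k;
  amul : alg_dg -> alg_dg -> alg_dg;
  aone : alg_dg;
  dgalgP : dgalg_axioms amul aone }.

Definition finite_type (A : dgalg) := forall n, finite_dim (fun a : A => homog n a).

Variable A : dgalg.

Record lmod_axioms (M : dgvect k) (act : A -> M -> M) : Prop := LModAxioms {
  lact_bilin : bilin act;
  lact1 : forall m, act (aone A) m = m;
  lactA : forall a b m, act (amul a b) m = act a (act b m);
  lact_deg : forall i j a m, homog i a -> homog j m -> homog (i + j) (act a m);
  lact_leibniz : forall i a m, homog i a ->
    dif (act a m) = act (dif a) m + (-1) ^ i *: act a (dif m) }.

Record rmod_axioms (M : dgvect k) (act : M -> A -> M) : Prop := RModAxioms {
  ract_bilin : bilin act;
  ract1 : forall m, act m (aone A) = m;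
  ractA : forall m a b, act m (amul a b) = act (act m a) b;
  ract_deg : forall i j m a, homog i m -> homog j a -> homog (i + j) (act m a);
  ract_leibniz : forall i m a, homog i m ->
    dif (act m a) = act (dif m) a + (-1) ^ i *: act m (dif a) }.

Record dglmod := DGLMod {
  lmod_dg :> dgvect k;
  lact : A -> lmod_dg -> lmod_dg;
  dglmodP : lmod_axioms lact }.

Record dgrmod := DGRMod {
  rmod_dg :> dgvect k;
  ract : rmod_dg -> A -> rmod_dg;
  dgrmodP : rmod_axioms ract }.

Record dgbimod := DGBimod {
  bimod_dg :> dgvect k;
  blact : A -> bimod_dg -> bimod_dg;
  bract : bimod_dg -> A -> bimod_dg;
  blactP : lmod_axioms blact;
  bractP : rmod_axioms bract;
  blactrA : forall a x b, bract (blact a x) b = blact a (bract x b) }.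

(* x lies in the graded submodule generated by m. *)
Definition lgenerated (M : dglmod) (m x : M) := forall S : M -> Prop,
  subspace S -> (forall n v, S v -> S (pr n v)) -> (forall a v, S v -> S (lact a v)) ->
  S m -> S x.
Definition rgenerated (M : dgrmod) (m x : M) := forall S : M -> Prop,
  subspace S -> (forall n v, S v -> S (pr n v)) -> (forall a v, S v -> S (ract v a)) ->
  S m -> S x.

Definition llocally_finite (M : dglmod) := forall m : M, finite_dim (lgenerated m).
Definition rlocally_finite (M : dgrmod) := forall m : M, finite_dim (rgenerated m).

Record lmodmor (M N : dglmod) := LModMor {
  lmodmor_fun :> M -> N;
  lmodmor_dg : dgmor lmodmor_fun;
  lmodmor_act : forall a m, lmodmor_fun (lact a m) = lact a (lmodmor_fun m) }.

Record rmodmor (M N : dgrmod) := RModMor {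
  rmodmor_fun :> M -> N;
  rmodmor_dg : dgmor rmodmor_fun;
  rmodmor_act : forall m a, rmodmor_fun (ract m a) = ract (rmodmor_fun m) a }.

Record bimodmor (M N : dgbimod) := BimodMor {
  bimodmor_fun :> M -> N;
  bimodmor_dg : dgmor bimodmor_fun;
  bimodmor_lact : forall a m, bimodmor_fun (blact a m) = blact a (bimodmor_fun m);
  bimodmor_ract : forall m a, bimodmor_fun (bract m a) = bract (bimodmor_fun m) a }.

Lemma alg_lmodP : lmod_axioms (@amul A).
Proof.
by case: (dgalgP A) => h1 h2 h3 h4 h5 h6 h7 h8; split=> // a b m; rewrite h2.
Qed.
Lemma alg_rmodP : rmod_axioms (@amul A).
Proof. by case: (dgalgP A) => h1 h2 h3 h4 h5 h6 h7 h8; split. Qed.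
Lemma alg_lrA (a x b : A) : amul (amul a x) b = amul a (amul x b).
Proof. by rewrite (mul_assoc (dgalgP A)). Qed.
Definition alg_bimod : dgbimod := DGBimod alg_lmodP alg_rmodP alg_lrA.

(* M \ox N with a (m \ox n) = a m \ox n and (m \ox n) a = m \ox n a. *)
Section TensorBimod.
Variables (M : dglmod) (N : dgrmod).
Local Notation T := (tensor_dg M N).

Let LP := dglmodP M.
Let RP := dgrmodP N.

Definition tlact (a : A) : T -> T := tmap (lact a) (fun n => n).
Definition tract (x : T) (a : A) : T := tmap (fun m => m) ((@ract N)^~ a) x.

Lemma tlact_linr a : linear (tlact a).
Proof. by apply: tmap_lin => //; apply: (lact_bilin LP).2. Qed.
Lemma tract_linl a : linear (tract^~ a).
Proof. by apply: tmap_lin => //; apply: (ract_bilin RP).1. Qed.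
Lemma tlactE a m n : tlact a (ten m n) = ten (lact a m) n.
Proof. by rewrite /tlact tmapE //; apply: (lact_bilin LP).2. Qed.
Lemma tractE a m n : tract (ten m n) a = ten m (ract n a).
Proof. by rewrite /tract tmapE //; apply: (ract_bilin RP).1. Qed.

Lemma tensor_deg (i : int) (f : T -> T) : linear f ->
  (forall p q (m : M) (n : N), homog p m -> homog q n -> homog (p + q + i) (f (ten m n))) ->
  forall j x, homog j x -> homog (j + i) (f x).
Proof.
move=> fl h j x hx; suff E y : f (pr j y) = pr (j + i) (f y) by rewrite /homog -E hx.
move: y {x hx}; apply: tgext.
- by apply: (lin_comp fl); apply: (@prl _ T).
- by apply: lin_comp fl; apply: (@prl _ T).
move=> p q m n hm hn /=; rewrite (tprE _ hm hn).
have := pr_homog (j + i) (h _ _ _ _ hm hn).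
rewrite (inj_eq (@addIr _ i)) => /= ->.
by case: eqP => _ //; rewrite (lin0 fl).
Qed.

Lemma tensor_lmodP : @lmod_axioms T tlact.
Proof.
split.
- split=> [x c a b|a]; last exact: tlact_linr.
  move: x; apply: ten_ext => [||m n]; first exact: tlact_linr.
    by apply: lin_add; [apply: lin_scale|]; apply: tlact_linr.
  by rewrite !tlactE ((lact_bilin LP).1 m) (ten_linl n).
- apply: ten_ext => [||m n]; rewrite ?tlactE ?(lact1 LP) //; exact: tlact_linr.
- move=> a b; apply: ten_ext => [||m n]; first exact: tlact_linr.
    by apply: lin_comp; apply: tlact_linr.
  by rewrite !tlactE (lactA LP).
- move=> i j a x ha hx; rewrite addrC; move: j x hx; apply: tensor_deg.
    exact: tlact_linr.
  move=> p q m n hm hn; rewrite tlactE addrC addrA; apply: homog_ten => //.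
  exact: lact_deg LP _ _ _ _ ha hm.
- move=> i a x ha; move: x; apply: tgext.
  + by apply: lin_comp; [exact: (@difl _ T)|exact: tlact_linr].
  + apply: lin_add; first exact: tlact_linr.
    by apply: lin_scale; apply: lin_comp; [exact: tlact_linr|exact: (@difl _ T)].
  move=> p q m n hm hn; rewrite !tlactE /= (tdifE _ (lact_deg LP ha hm)) (tdifE _ hm).
  rewrite (linD (tlact_linr a)) (linZ (tlact_linr a)) !tlactE (lact_leibniz LP _ ha).
  rewrite (linD (ten_linl n)) (linZ (ten_linl n)) scalerDr scalerA -signD.
  by rewrite addrA.
Qed.

Lemma tensor_rmodP : @rmod_axioms T tract.
Proof.
split.
- split=> [a|x c a b]; first exact: tract_linl.
  move: x; apply: ten_ext => [||m n]; first exact: tract_linl.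
    by apply: lin_add; [apply: lin_scale|]; apply: tract_linl.
  by rewrite !tractE ((ract_bilin RP).2 n) (ten_linr m).
- apply: ten_ext => [||m n]; rewrite ?tractE ?(ract1 RP) //; exact: tract_linl.
- move=> x a b; move: x; apply: ten_ext => [||m n]; first exact: tract_linl.
    by apply: lin_comp; [exact: (tract_linl b)|exact: (tract_linl a)].
  by rewrite !tractE (ractA RP).
- move=> j i x a hx ha; move: j x hx; apply: (@tensor_deg i (tract^~ a)).
    exact: tract_linl.
  move=> p q m n hm hn; rewrite tractE -addrA; apply: homog_ten => //.
  exact: ract_deg RP _ _ _ _ hn ha.
- move=> i x a hx.
  suff -> : dif (tract x a) = tract (dif x) a + tract (ksign 1 x) (dif a).
    by rewrite (ksignE 1 hx) mul1r (linZ (tract_linl _)).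
  move: x {hx}; apply: tgext.
  + by apply: lin_comp; [exact: (@difl _ T)|exact: (tract_linl a)].
  + apply: lin_add; apply: lin_comp; first [exact: (tract_linl _)|exact: (@difl _ T)|exact: (@ksign_lin _ T)].
  move=> p q m n hm hn; rewrite (@ksignE _ T 1 _ _ (homog_ten hm hn)).
  rewrite /= (linZ (tract_linl _)) !tractE !(tdifE _ hm) (linD (tract_linl a)) (linZ (tract_linl a)).
  rewrite !tractE (ract_leibniz RP _ hn) (linD (ten_linr m)) (linZ (ten_linr m)).
  by rewrite scalerDr scalerA -signD mul1r addrA.
Qed.

Lemma tensor_lrA (a : A) (x : T) (b : A) : tract (tlact a x) b = tlact a (tract x b).
Proof.
move: x; apply: ten_ext => [||m n].
- by apply: lin_comp; [exact: (tract_linl b)|exact: tlact_linr].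
- by apply: lin_comp; [exact: tlact_linr|exact: (tract_linl b)].
- by rewrite tlactE !tractE tlactE.
Qed.

Definition tensor_bimod : dgbimod := DGBimod tensor_lmodP tensor_rmodP tensor_lrA.

End TensorBimod.

Section TensorBimodMor.
Variables (M M' : dglmod) (N N' : dgrmod) (f : lmodmor M M') (g : rmodmor N N').

Let fl := dgmor_lin (lmodmor_dg f).
Let gl := dgmor_lin (rmodmor_dg g).

Lemma tmap_lact a (x : tensor_bimod M N) :
  tmap f g (blact a x) = @blact (tensor_bimod M' N') a (tmap f g x).
Proof.
have tl : linear (tmap f g) by apply: tmap_lin.
move: x; apply: ten_ext => [||m n].
- by apply: lin_comp; [exact: tl|exact: tlact_linr].
- by apply: lin_comp; [exact: tlact_linr|exact: tl].
- by rewrite /= tlactE !tmapE // tlactE lmodmor_act.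
Qed.

Lemma tmap_ract (x : tensor_bimod M N) a :
  tmap f g (bract x a) = @bract (tensor_bimod M' N') (tmap f g x) a.
Proof.
have tl : linear (tmap f g) by apply: tmap_lin.
move: x; apply: ten_ext => [||m n].
- by apply: lin_comp; [exact: tl|exact: (tract_linl a)].
- by apply: lin_comp; [exact: (tract_linl a)|exact: tl].
- by rewrite /= tractE !tmapE // tractE rmodmor_act.
Qed.

Definition tensor_bimodmor : bimodmor (tensor_bimod M N) (tensor_bimod M' N') :=
  @BimodMor (tensor_bimod M N) (tensor_bimod M' N') _ (tmap_dg (lmodmor_dg f) (rmodmor_dg g)) tmap_lact tmap_ract.

End TensorBimodMor.

Section HomBimod.
Variables X Y : dgbimod.

(* Every homogeneous component f_p of f is a degree p map of graded bimodules:
   f_p (a x) = (-1)^(p |a|) a f_p (x) and f_p (x b) = f_p (x) b. *)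
Definition bimod_hom (f : hom_dg X Y) := forall p,
  (forall i a x, homog i a ->
    incl (pr p f) (blact a x) = (-1) ^ (p * i) *: blact a (incl (pr p f) x)) /\
  (forall x b, incl (pr p f) (bract x b) = bract (incl (pr p f) x) b).

Lemma bimod_hom_dgsub : dgsubspace bimod_hom.
Proof.
have L := blactP Y; have R := bractP Y.
split.
- split=> [p|c f g hf hg p].
    rewrite (lin0 (@prl _ (hom_dg X Y) p)) (lin0 (@incl_lin _ _ _ _)).
    split=> [i a x _|x b] /=.
      by rewrite (lin0 ((lact_bilin L).2 a)) scaler0.
    by rewrite (lin0 ((ract_bilin R).1 b)).
  have E x : incl (pr p (c *: f + g)) x = c *: incl (pr p f) x + incl (pr p g) x.
    by rewrite (@prl _ (hom_dg X Y) p) hom_combE.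
  have [f1 f2] := hf p; have [g1 g2] := hg p.
  split=> [i a x ha|x b]; rewrite !E.
    rewrite (f1 i) // (g1 i) // ((lact_bilin L).2 a) scalerDr !scalerA.
    by rewrite [c * _]mulrC.
  by rewrite f2 g2 ((ract_bilin R).1 b).
- move=> n f hf p; rewrite prpr; case: eqP => [->|_]; first exact: hf.
  split=> [i a x _|x b]; rewrite (lin0 (@incl_lin _ _ _ _)) /=.
    by rewrite (lin0 ((lact_bilin L).2 a)) scaler0.
  by rewrite (lin0 ((ract_bilin R).1 b)).
move=> f hf p.
have e : pr p (dif f) = dif (pr (p - 1) f) by rewrite pr_dif.
have hg := homog_pr (p - 1) f; have [g1 g2] := hf (p - 1).
rewrite e; move: (pr (p - 1) f) hg g1 g2 => g hg g1 g2 {e}.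
have gl := hom_lin g.
split=> [i a x ha|x b]; rewrite !(hom_difE _ hg).
  rewrite (g1 i) // (linZ difl) (lact_leibniz L _ ha) (lact_leibniz (blactP X) _ ha).
  rewrite (linD gl) (linZ gl) (g1 (i + 1)) ?(g1 i) //; last exact: dif_homog.
  rewrite (linB ((lact_bilin L).2 a)) (linZ ((lact_bilin L).2 a)).
  rewrite !scalerDr !scalerA -!signD opprD addrACA.
  have -> : (-1) ^ (p - 1 + (p - 1) * (i + 1)) = (-1) ^ ((p - 1) * i) :> k.
    by apply: (@sign_eq _ (p - 1)); ring.
  rewrite subrr add0r.
  have -> : (-1) ^ ((p - 1) * i + i) = (-1) ^ (p * i) :> k by congr (_ ^ _); ring.
  rewrite scalerN scalerA -signD; congr (_ - _ *: _).
  by congr (_ ^ _); ring.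
move: x; apply: gext.
- apply: lin_add; first by apply: (lin_comp difl); apply: (lin_comp gl); apply: (ract_bilin (bractP X)).1.
  apply: lin_opp; apply: lin_scale; apply: (lin_comp gl); apply: (lin_comp difl).
  exact: (ract_bilin (bractP X)).1.
- apply: (lin_comp ((ract_bilin R).1 b)); apply: lin_add; first exact: lin_comp difl gl.
  by apply: lin_opp; apply: lin_scale; exact: lin_comp gl difl.
move=> j x hx; have hgx := (hom_homogP (p - 1) g).1 hg _ _ hx.
rewrite g2 (ract_leibniz R _ hgx) (ract_leibniz (bractP X) _ hx).
rewrite (linD gl) (linZ gl) !g2 (linB ((ract_bilin R).1 b)) (linZ ((ract_bilin R).1 b)).
rewrite scalerDr opprD addrACA scalerA -signD [X in _ + X](_ : _ = 0) ?addr0 //.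
by rewrite [p - 1 + j]addrC subrr.
Qed.

Definition homAe : dgvect k := sub_dg bimod_hom_dgsub.

End HomBimod.

Section HomBimodMap.
Variables (X Y Z : dgbimod) (h : bimodmor Y Z).

Let hd := bimodmor_dg h.
Let hl := dgmor_lin hd.

Lemma comp_hom_gr (f : hom_dg X Y) : gradedhom (fun x : X => h (incl f x) : Z).
Proof.
have [fl [s hs]] := inclE f; split; first exact: lin_comp hl fl.
by exists s => p i a ps ha; rewrite -(dgmor_pr hd) (hs p i) // (lin0 hl).
Qed.

Definition hom_post (f : hom_dg X Y) : hom_dg X Z := mksub _ (comp_hom_gr f).

Lemma pr_hom_post p f x : incl (pr p (hom_post f)) x = h (incl (pr p f) x).
Proof.
move: x; apply: gext; first exact: hom_lin.
  by apply: (lin_comp hl); apply: hom_lin.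
move=> i a ha; rewrite /= !(comp_funE _ _ ha); try exact: hom_lin.
  by rewrite (dgmor_pr hd).
exact: hom_lin (hom_post f).
Qed.

Lemma hom_post_bimod f : bimod_hom f -> bimod_hom (hom_post f).
Proof.
move=> hf p; have [f1 f2] := hf p; split=> [i a x ha|x b]; rewrite !pr_hom_post.
  by rewrite (f1 i) // (linZ hl) bimodmor_lact.
by rewrite f2 bimodmor_ract.
Qed.

Definition homAe_map (f : homAe X Y) : homAe X Z :=
  mksub _ (hom_post_bimod (inclE f)).

End HomBimodMap.

End Algebra.

Section Coalgebra.
Variable k : fieldType.

(* In the cohomological grading the differential of a coalgebra or comodule (of
   degree -1 for the chain grading) has degree +1, and a non-negatively graded
   coalgebra is concentrated in degrees n <= 0. That comul is a dgmor is the
   co-Leibniz rule. *)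
Record dgcoalg_axioms (C : dgvect k) (comul : C -> tensor_dg C C) (counit : C -> unit_dg k) :
  Prop := DGCoalgAxioms {
  comul_dg : dgmor comul;
  counit_dg : dgmor counit;
  comulA : forall c, tassoc (tmap comul id (comul c)) = tmap id comul (comul c);
  counitl : forall c, tlift (fun c1 c2 => (counit c1 : k) *: c2) (comul c) = c;
  counitr : forall c, tlift (fun c1 c2 => (counit c2 : k) *: c1) (comul c) = c;
  coalg_nonneg : forall n (c : C), 0 < n -> homog n c -> c = 0 }.

Record dgcoalg := DGCoalg {
  coalg_dg :> dgvect k;
  comul : coalg_dg -> tensor_dg coalg_dg coalg_dg;
  counit : coalg_dg -> unit_dg k;
  dgcoalgP : dgcoalg_axioms comul counit }.

Variable C : dgcoalg.

Record rcomod_axioms (M : dgvect k) (rho : M -> tensor_dg M C) : Prop := RComodAxioms {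
  rcoact_dg : dgmor rho;
  rcoactA : forall m, tassoc (tmap rho id (rho m)) = tmap id (@comul C) (rho m);
  rcoact1 : forall m, tlift (fun m' c => (counit c : k) *: m') (rho m) = m }.

Record lcomod_axioms (N : dgvect k) (lam : N -> tensor_dg C N) : Prop := LComodAxioms {
  lcoact_dg : dgmor lam;
  lcoactA : forall n, tassoc (tmap (@comul C) id (lam n)) = tmap id lam (lam n);
  lcoact1 : forall n, tlift (fun c n' => (counit c : k) *: n') (lam n) = n }.

Record dgrcomod := DGRComod {
  rcomod_dg :> dgvect k;
  rcoact : rcomod_dg -> tensor_dg rcomod_dg C;
  dgrcomodP : rcomod_axioms rcoact }.

Record dglcomod := DGLComod {
  lcomod_dg :> dgvect k;
  lcoact : lcomod_dg -> tensor_dg C lcomod_dg;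
  dglcomodP : lcomod_axioms lcoact }.

Record rcomodmor (M N : dgrcomod) := RComodMor {
  rcomodmor_fun :> M -> N;
  rcomodmor_dg : dgmor rcomodmor_fun;
  rcomodmor_coact : forall m, rcoact (rcomodmor_fun m) = tmap rcomodmor_fun id (rcoact m) }.

Record lcomodmor (M N : dglcomod) := LComodMor {
  lcomodmor_fun :> M -> N;
  lcomodmor_dg : dgmor lcomodmor_fun;
  lcomodmor_coact : forall m, lcoact (lcomodmor_fun m) = tmap id lcomodmor_fun (lcoact m) }.

Section Cotensor.
Variables (M : dgrcomod) (N : dglcomod).

Definition cotensor_cond (x : tensor_dg M N) : Prop :=
  tassoc (tmap (@rcoact M) id x) - tmap id (@lcoact N) x = 0.

Lemma dgmor_comp (U V W : dgvect k) (f : V -> W) (g : U -> V) :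
  dgmor f -> dgmor g -> dgmor (fun x => f (g x)).
Proof.
move=> hf hg; split=> [|n v|v].
- exact: lin_comp (dgmor_lin hf) (dgmor_lin hg).
- by rewrite (dgmor_pr hg) (dgmor_pr hf).
- by rewrite (dgmor_d hg) (dgmor_d hf).
Qed.

Lemma cotensor_dgl : @dgmor _ (tensor_dg M N) (tensor_dg M (tensor_dg C N))
  (fun x => tassoc (tmap (@rcoact M) id x)).
Proof.
have h1 := @tassoc_dg _ M C N.
have h2 := tmap_dg (rcoact_dg (dgrcomodP M)) (@dgmor_id _ N).
exact: dgmor_comp h1 h2.
Qed.

Lemma cotensor_dgr : @dgmor _ (tensor_dg M N) (tensor_dg M (tensor_dg C N))
  (tmap id (@lcoact N)).
Proof. exact: tmap_dg (@dgmor_id _ M) (lcoact_dg (dglcomodP N)). Qed.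

Lemma cotensor_dgsub : dgsubspace cotensor_cond.
Proof.
have L := cotensor_dgl; have R := cotensor_dgr.
rewrite /cotensor_cond; split.
- split=> [|c x y /subr0_eq hx /subr0_eq hy].
    by rewrite (lin0 (dgmor_lin L)) (lin0 (dgmor_lin R)) subrr.
  by rewrite (dgmor_lin L) (dgmor_lin R) /= hx hy subrr.
- by move=> n x /subr0_eq h; rewrite (dgmor_pr L) (dgmor_pr R) h subrr.
- by move=> x /subr0_eq h; rewrite (dgmor_d L) (dgmor_d R) h subrr.
Qed.

Definition cotensor : dgvect k := sub_dg cotensor_dgsub.

End Cotensor.

Section CotensorMap.
Variables (M M' : dgrcomod) (N N' : dglcomod) (f : rcomodmor M M') (g : lcomodmor N N').

Lemma cotensor_map_cond (x : tensor_dg M N) :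
  cotensor_cond x -> cotensor_cond (tmap f g x).
Proof.
have fl := dgmor_lin (rcomodmor_dg f); have gl := dgmor_lin (lcomodmor_dg g).
have rl := dgmor_lin (rcoact_dg (dgrcomodP M)); have rl' := dgmor_lin (rcoact_dg (dgrcomodP M')).
have ll := dgmor_lin (lcoact_dg (dglcomodP N)); have ll' := dgmor_lin (lcoact_dg (dglcomodP N')).
have idl (V : lmodType k) : linear (@id V) by [].
have hL : tmap (@rcoact M') id (tmap f g x) = tmap (tmap f id) g (tmap (@rcoact M) id x).
  rewrite !tmap_comp //; last exact: tmap_lin.
  by congr (tmap _ _ x); apply: funext => m; rewrite rcomodmor_coact.
have hR : tmap id (@lcoact N') (tmap f g x) = tmap f (tmap id g) (tmap id (@lcoact N) x).
  rewrite !tmap_comp //; last exact: tmap_lin.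
  by congr (tmap _ _ x); apply: funext => m; rewrite lcomodmor_coact.
have hA y : tassoc (tmap (tmap f id) g y) = tmap f (tmap id g) (tassoc y) :> tensor M' (tensor C N').
  move: y; apply: ten_ext3.
  - by apply: lin_comp; [exact: tassoc_lin|apply: tmap_lin => //; apply: tmap_lin].
  - by apply: lin_comp; [apply: tmap_lin => //; apply: tmap_lin|exact: tassoc_lin].
  - move=> m c n; rewrite tassocE !tmapE ?tassocE //; by apply: tmap_lin.
rewrite /cotensor_cond => /subr0_eq h.
by apply/eqP; rewrite subr_eq0 hL hR hA h.
Qed.

Definition cotensor_map (x : cotensor M N) : cotensor M' N' :=
  mksub _ (cotensor_map_cond (inclE x)).

End CotensorMap.
End Coalgebra.

Section SignLemmas.
Variable k : fieldType.

Lemma sign_sq (m : int) : (-1) ^ m * (-1) ^ m = 1 :> k.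
Proof. by rewrite -signD (@sign_eq _ m _ 0) ?expr0z // add0r mulr2n. Qed.

Lemma signN (m : int) : - (-1) ^ m = (-1) ^ (m + 1) :> k.
Proof. by rewrite signD sign1 mulrN1. Qed.

Lemma ksign0 (V : gvect k) (v : V) : ksign 0 v = v.
Proof.
move: v; apply: gext => [||n v hv]; [exact: ksign_lin|by []|].
by rewrite (ksignE _ hv) mul0r expr0z scale1r.
Qed.

Lemma ksignM (V : gvect k) m n (v : V) : ksign m (ksign n v) = ksign (m + n) v.
Proof.
move: v; apply: gext => [||i v hv]; [|exact: ksign_lin|].
  exact: lin_comp (ksign_lin m) (ksign_lin n).
rewrite (ksignE n hv) (linZ (ksign_lin m)) !(ksignE _ hv) scalerA -signD.
by congr (_ *: _); congr (_ ^ _); ring.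
Qed.

Lemma ksignK (V : gvect k) m (v : V) : ksign m (ksign m v) = v.
Proof.
move: v; apply: gext => [||i v hv]; [|by []|].
  exact: lin_comp (ksign_lin m) (ksign_lin m).
by rewrite (ksignE m hv) (linZ (ksign_lin m)) !(ksignE _ hv) scalerA sign_sq scale1r.
Qed.

End SignLemmas.

Section Dual.
Variables (k : fieldType) (A : dgalg k).

(* DA is the graded dual: its part of degree - n is Hom(A^n, k). *)
Definition dual_dg : dgvect k := hom_dg A (unit_dg k).
Local Notation C := dual_dg.

Definition ev (phi : C) (a : A) : k := incl phi a.

Lemma ev_linl a : linear (fun phi : C => ev phi a : k^o).
Proof. by move=> c f g; rewrite /ev hom_combE. Qed.
Lemma ev_linr phi : linear (fun a => ev phi a : k^o).
Proof. exact: (hom_lin phi). Qed.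

Lemma ev_pr n phi a : ev (pr n phi) a = ev phi (pr (- n) a).
Proof.
move: a; apply: (@gext _ _ k^o) => [||i a ha].
- exact: ev_linr.
- by apply: (lin_comp (ev_linr phi)); exact: prl.
rewrite /ev /= (comp_funE _ (hom_lin phi) ha) /= /unit_pr (pr_homog _ ha).
rewrite [- n == i]eq_sym -[i == - n]addr_eq0.
by case: eqP => // _; rewrite (lin0 (hom_lin phi)).
Qed.

Lemma ev_homog n phi i a : homog n phi -> homog i a -> i != - n -> ev phi a = 0.
Proof.
by move=> <- ha ni; rewrite ev_pr (pr_homog _ ha) eq_sym (negPf ni) (lin0 (ev_linr phi)).
Qed.

Lemma dual_eq (phi psi : C) : (forall i a, homog i a -> ev phi a = ev psi a) -> phi = psi.
Proof. by move=> h; apply: hom_eq. Qed.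

Lemma ksign_unit m (x : unit_dg k) : ksign m x = x.
Proof.
have hx : homog 0 x by [].
by rewrite (ksignE _ hx) mulr0 expr0z scale1r.
Qed.

Lemma ev_dif phi i a : homog i a -> ev (dif phi) a = (-1) ^ i * ev phi (dif a).
Proof.
move=> ha; rewrite /ev /= /dif_fun /= sub0r ksign_unit (ksignE _ (dif_homog ha)).
rewrite (linZ (hom_lin phi)) mul1r signD sign1 mulrN1 scaleNr opprK.
by [].
Qed.

Definition dual_counit (phi : C) : unit_dg k := ev phi (aone A).

(* Unsigned evaluations: v \ox phi |-> phi(a) v, phi \ox v |-> phi(a) v and
   phi \ox psi |-> phi(a) psi(b). *)
Definition pairR (V : lmodType k) (x : tensor V C) (a : A) : V :=
  tlift (fun v phi => ev phi a *: v) x.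
Definition pairL (V : lmodType k) (x : tensor C V) (a : A) : V :=
  tlift (fun phi v => ev phi a *: v) x.
Definition pair2 (x : tensor C C) (a b : A) : k :=
  tlift (fun phi psi => ev phi a * ev psi b : k^o) x.

Lemma scale_lin (V : lmodType k) (v : V) : linear (fun c : k^o => (c : k) *: v).
Proof. by move=> c x y; rewrite scalerDl scalerA. Qed.

Lemma pairR_bilin (V : lmodType k) a : bilin (fun (v : V) (phi : C) => ev phi a *: v).
Proof.
split=> [phi|v]; first exact: lin_scale.
exact: (lin_comp (scale_lin v) (ev_linl a)).
Qed.
Lemma pairL_bilin (V : lmodType k) a : bilin (fun (phi : C) (v : V) => ev phi a *: v).
Proof. by have [h1 h2] := pairR_bilin V a. Qed.
Lemma pair2_bilin a b : bilin (fun phi psi : C => ev phi a * ev psi b : k^o).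
Proof.
split=> [psi|phi] c x y.
- by rewrite (ev_linl a) mulrDl -mulrA.
- by rewrite (ev_linl b) mulrDr mulrCA.
Qed.

Lemma pairRE (V : lmodType k) (v : V) phi a : pairR (ten v phi) a = ev phi a *: v.
Proof. by rewrite /pairR tliftE //; exact: pairR_bilin. Qed.
Lemma pairLE (V : lmodType k) (v : V) phi a : pairL (ten phi v) a = ev phi a *: v.
Proof. by rewrite /pairL tliftE //; exact: pairL_bilin. Qed.
Lemma pair2E phi psi a b : pair2 (ten phi psi) a b = ev phi a * ev psi b.
Proof. by rewrite /pair2 tliftE //; exact: pair2_bilin. Qed.

Lemma pairR_lin (V : lmodType k) a : linear (fun x : tensor V C => pairR x a).
Proof. exact: tlift_lin (pairR_bilin V a). Qed.
Lemma pairL_lin (V : lmodType k) a : linear (fun x : tensor C V => pairL x a).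
Proof. exact: tlift_lin (pairL_bilin V a). Qed.
Lemma pair2_lin a b : linear (fun x : tensor C C => pair2 x a b : k^o).
Proof. exact: tlift_lin (pair2_bilin a b). Qed.

Lemma pairR_linr (V : lmodType k) (x : tensor V C) : linear (pairR x).
Proof.
move=> c a b; move: x; apply: ten_ext => [||v phi].
- exact: pairR_lin.
- by apply: lin_add; [apply: lin_scale|]; exact: pairR_lin.
- by rewrite !pairRE (ev_linr phi) scalerDl scalerA.
Qed.
Lemma pairL_linr (V : lmodType k) (x : tensor C V) : linear (pairL x).
Proof.
move=> c a b; move: x; apply: ten_ext => [||phi v].
- exact: pairL_lin.
- by apply: lin_add; [apply: lin_scale|]; exact: pairL_lin.
- by rewrite !pairLE (ev_linr phi) scalerDl scalerA.
Qed.

Lemma ev_pairR (x : tensor C C) a b : ev (pairR x b) a = pair2 x a b.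
Proof.
move: x; apply: (@ten_ext _ _ _ k^o) => [||phi psi].
- exact: (lin_comp (ev_linl a) (pairR_lin (V := C) b)).
- exact: pair2_lin.
- by rewrite pairRE pair2E (linZ (ev_linl a)) mulrC.
Qed.
Lemma ev_pairL (x : tensor C C) a b : ev (pairL x a) b = pair2 x a b.
Proof.
move: x; apply: (@ten_ext _ _ _ k^o) => [||phi psi].
- exact: (lin_comp (ev_linl b) (pairL_lin (V := C) a)).
- exact: pair2_lin.
- by rewrite pairLE pair2E (linZ (ev_linl b)).
Qed.

Lemma pairR_map (V W : lmodType k) (f : V -> W) x a : linear f ->
  pairR (tmap f id x) a = f (pairR x a).
Proof.
move=> fl; move: x; apply: ten_ext => [||v phi].
- by apply: (lin_comp (pairR_lin a)); exact: tmap_lin.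
- exact: (lin_comp fl (pairR_lin a)).
- by rewrite tmapE // !pairRE (linZ fl).
Qed.
Lemma pairL_map (V W : lmodType k) (f : V -> W) x a : linear f ->
  pairL (tmap id f x) a = f (pairL x a).
Proof.
move=> fl; move: x; apply: ten_ext => [||phi v].
- by apply: (lin_comp (pairL_lin a)); exact: tmap_lin.
- exact: (lin_comp fl (pairL_lin a)).
- by rewrite tmapE // !pairLE (linZ fl).
Qed.

Lemma pairR_pr (V : dgvect k) n (x : tensor_dg V C) i a : homog i a ->
  pairR (pr n x) a = pr (n + i) (pairR x a).
Proof.
move=> ha; move: x; apply: tgext => [||p q v phi hv hp].
- by apply: (lin_comp (pairR_lin a)); exact: (@prl _ (tensor_dg V C)).
- exact: (lin_comp (prl _) (pairR_lin a)).
rewrite /= (tprE _ hv hp) pairRE (linZ (prl _)) (pr_homog _ hv).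
have [iq|niq] := eqVneq i (- q).
  rewrite iq subr_eq; case: eqP => _; first by rewrite pairRE.
  by rewrite (lin0 (pairR_lin a)) scaler0.
rewrite (ev_homog hp ha niq) scale0r.
by case: eqP => _; rewrite ?pairRE ?(ev_homog hp ha niq) ?scale0r // (lin0 (pairR_lin a)).
Qed.
Lemma pairL_pr (V : dgvect k) n (x : tensor_dg C V) i a : homog i a ->
  pairL (pr n x) a = pr (n + i) (pairL x a).
Proof.
move=> ha; move: x; apply: tgext => [||q p phi v hp hv].
- by apply: (lin_comp (pairL_lin a)); exact: (@prl _ (tensor_dg C V)).
- exact: (lin_comp (prl _) (pairL_lin a)).
rewrite /= (tprE _ hp hv) pairLE (linZ (prl _)) (pr_homog _ hv).
have [iq|niq] := eqVneq i (- q).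
  rewrite iq subr_eq [p + q]addrC; case: eqP => _; first by rewrite pairLE.
  by rewrite (lin0 (pairL_lin a)) scaler0.
rewrite (ev_homog hp ha niq) scale0r.
by case: eqP => _; rewrite ?pairLE ?(ev_homog hp ha niq) ?scale0r // (lin0 (pairL_lin a)).
Qed.

Lemma pairR_dif (V : dgvect k) (x : tensor_dg V C) i a : homog i a ->
  pairR (dif x) a = dif (pairR x a) - pairR (ksign 1 x) (dif a).
Proof.
move=> ha; move: x; apply: tgext => [||p q v phi hv hp].
- by apply: (lin_comp (pairR_lin a)); exact: (@difl _ (tensor_dg V C)).
- apply: lin_add; first exact: (lin_comp difl (pairR_lin a)).
  by apply: lin_opp; apply: (lin_comp (pairR_lin _)); exact: (@ksign_lin _ (tensor_dg V C)).
rewrite (@ksignE _ (tensor_dg V C) 1 _ _ (homog_ten hv hp)).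
rewrite /= (tdifE _ hv) (linD (pairR_lin a)) !(linZ (pairR_lin _)) !pairRE (linZ difl).
congr (_ + _); rewrite (ev_dif _ ha) !scalerA mulrA -signD -scaleNr mul1r; congr (_ *: _).
have [iq|niq] := eqVneq (i + 1) (- q); last by rewrite (ev_homog hp (dif_homog ha) niq) !mulr0 oppr0.
rewrite -mulNr signN; congr (_ * _); apply: (@sign_eq _ (- 1 - q)).
have -> : i = - q - 1 by rewrite -iq addrK.
by ring.
Qed.
Lemma pairL_dif (V : dgvect k) (x : tensor_dg C V) i a : homog i a ->
  pairL (dif x) a = (-1) ^ i *: (pairL x (dif a) + dif (pairL x a)).
Proof.
move=> ha; move: x; apply: tgext => [||q p phi v hp hv].
- by apply: (lin_comp (pairL_lin a)); exact: (@difl _ (tensor_dg C V)).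
- by apply: lin_scale; apply: lin_add; [exact: pairL_lin|exact: (lin_comp difl (pairL_lin a))].
rewrite /= (tdifE _ hp) (linD (pairL_lin a)) !(linZ (pairL_lin _)) !pairLE (linZ difl).
rewrite (ev_dif _ ha) scalerDr !scalerA; congr (_ + _ *: _).
have [iq|niq] := eqVneq i (- q); last by rewrite (ev_homog hp ha niq) !mulr0.
by congr (_ * _); apply: (@sign_eq _ q); rewrite iq; ring.
Qed.

Lemma pair2_dif (x : tensor_dg C C) i j a b : homog i a -> homog j b ->
  pair2 (dif x) a b = (-1) ^ i * pair2 x (dif a) b + (-1) ^ (i + j) * pair2 x a (dif b).
Proof.
move=> ha hb; move: x; apply: (@tgext _ _ _ k^o) => [||p q phi psi hp hq].
- by apply: (lin_comp (pair2_lin a b)); exact: (@difl _ (tensor_dg C C)).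
- by apply: (@lin_add _ _ k^o); apply: (@lin_scale _ _ k^o); exact: pair2_lin.
rewrite /= (tdifE _ hp) (linD (pair2_lin a b)) (linZ (pair2_lin a b)) /= !pair2E.
rewrite (ev_dif _ ha) (ev_dif _ hb) -[_ *: _]/(_ * _) mulrA; congr (_ + _); first by rewrite mulrA.
have [ip|nip] := eqVneq i (- p); last by rewrite (ev_homog hp ha nip) !(mul0r, mulr0).
have -> : (-1) ^ p = (-1) ^ i :> k by apply: (@sign_eq _ p); rewrite ip; ring.
by rewrite signD; ring.
Qed.

Lemma pair2_pr n (x : tensor_dg C C) i j a b : homog i a -> homog j b ->
  pair2 (pr n x) a b = if n == - (i + j) then pair2 x a b else 0.
Proof.
move=> ha hb; rewrite -!ev_pairR.
rewrite (pairR_pr _ _ hb) ev_pr (pr_homog _ ha).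
rewrite eq_sym -addr_eq0 -[n == _]addr_eq0.
have -> : i + (n + j) = n + - - (i + j) by ring.
by rewrite opprK; case: eqP => // _; rewrite (lin0 (ev_linr _)).
Qed.

End Dual.

Section DualBasis.
Variables (k : fieldType) (A : dgalg k) (ftA : finite_type A).
Local Notation C := (dual_dg A).

Definition spans i n := exists e : 'I_n -> A, (forall j, homog i (e j)) /\
  forall a, homog i a -> exists c : 'I_n -> k, a = \sum_j c j *: e j.

Lemma spans_exists i : exists n, `[< spans i n >].
Proof.
have [s hs] := ftA i; exists (size s); apply/asboolP.
exists (fun j => pr i s`_j); split=> [j|a ha]; first exact: homog_pr.
have [c E] := hs a ha; exists (fun j => c j).
rewrite -{1}ha {1}E (lin_sum _ _ (prl i)); apply: eq_bigr => j _.
by rewrite (linZ (prl i)).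
Qed.

Lemma dual_basis i : exists s : seq (A * C),
  (forall p, p \in s -> homog i p.1 /\ homog (- i) p.2) /\
  forall a, homog i a -> a = \sum_(p <- s) ev p.2 a *: p.1.
Proof.
have [n /asboolP[e [he sp]] nmin] := ex_minnP (spans_exists i).
have free (c : 'I_n -> k) : \sum_j c j *: e j = 0 -> forall j, c j = 0.
  move=> E j0; apply/eqP/negP => /negP cj0.
  case: n e he sp nmin c E j0 cj0 => [|n] e he sp nmin c E j0 cj0; first by case: j0 cj0.
  have : spans i n.
    exists (fun l => e (lift j0 l)); split=> // a ha; have [d Ed] := sp a ha.
    exists (fun l => d (lift j0 l) - d j0 / c j0 * c (lift j0 l)).
    rewrite Ed (bigD1_ord j0) //=.
    have -> : e j0 = - (\sum_l (c j0)^-1 * c (lift j0 l) *: e (lift j0 l)).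
      apply: (scalerI cj0); rewrite scalerN scaler_sumr; apply/eqP.
      rewrite -addr_eq0; apply/eqP; rewrite -[RHS]E [in RHS](bigD1_ord j0) //=.
      by congr (_ + _); apply: eq_bigr => l _; rewrite scalerA mulrA mulfV // mul1r.
    rewrite scalerN scaler_sumr addrC -sumrB; apply: eq_bigr => l _.
    by rewrite scalerA scalerBl !mulrA.
  by move=> /asboolP /nmin; rewrite ltnn.
pose coef (a : A) : 'I_n -> k := sval (cid (sp (pr i a) (homog_pr i a))).
have coefE a : pr i a = \sum_j coef a j *: e j by rewrite /coef; case: cid.
have uniq_coef a c : pr i a = \sum_j c j *: e j -> forall j, c j = coef a j.
  move=> E j; apply/eqP; rewrite -subr_eq0; apply/eqP.
  apply: (free (fun j => c j - coef a j)).
  rewrite (eq_bigr (fun j => c j *: e j - coef a j *: e j)) => [|l _].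
    by rewrite sumrB -E coefE subrr.
  by rewrite scalerBl.
have coef_lin j : linear (fun a => coef a j : k^o).
  move=> c a b; rewrite -(uniq_coef _ (fun j => c * coef a j + coef b j)) //.
  rewrite (prl i) !coefE scaler_sumr -big_split /=; apply: eq_bigr => l _.
  by rewrite scalerDl scalerA.
have coef0 j l a : homog l a -> l != i -> coef a j = 0.
  move=> ha li; rewrite -(uniq_coef a (fun _ => 0)) //.
  rewrite big1 => [|l' _]; last by rewrite scale0r.
  by rewrite (pr_homog _ ha) eq_sym (negPf li).
have gh j : @gradedhom _ A (unit_dg k) (fun a => coef a j).
  split; first exact: coef_lin.
  exists [:: - i] => p l a; rewrite inE => np ha /=; rewrite /unit_pr.
  case: eqP => // lp; apply: (coef0 _ _ _ ha).
  by apply: contra np => /eqP li; rewrite -addr_eq0 addrC -li lp.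
pose phi j : C := mksub (gradedhom_subspace _ _) (gh j).
exists [seq (e j, phi j) | j <- enum 'I_n]; split.
  move=> p /mapP[j _ ->]; split; first exact: he.
  apply/hom_homogP => l a ha /=; rewrite /homog /= /unit_pr.
  case: eqP => // li; rewrite (coef0 _ _ _ ha) //; apply/eqP => e'.
  by apply: li; rewrite e' subrr.
by move=> a ha; rewrite big_map big_enum /= -{1}ha coefE.
Qed.

Definition dbas i : seq (A * C) := sval (cid (dual_basis i)).
Lemma dbas_homog i p : p \in dbas i -> homog i p.1 /\ homog (- i) p.2.
Proof. by rewrite /dbas; case: cid => s /= [h _]; apply: h. Qed.
Lemma dbas_sum i a : homog i a -> a = \sum_(p <- dbas i) ev p.2 a *: p.1.
Proof. by rewrite /dbas; case: cid => s /= [_ h]; apply: h. Qed.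

Lemma dbas_dual i (phi : C) : pr (- i) phi = \sum_(p <- dbas i) ev phi p.1 *: p.2.
Proof.
apply: dual_eq => j a ha; rewrite (lin_sum _ _ (ev_linl a)) ev_pr opprK (pr_homog _ ha).
have [ij|nij] := eqVneq i j.
  rewrite {1}(dbas_sum (i := i) (a := a)); last by rewrite ij.
  rewrite (lin_sum _ _ (ev_linr phi)); apply: eq_bigr => p _.
  by rewrite (linZ (ev_linr phi)) (linZ (ev_linl a)) -[_ *: _]/(_ * _) -[X in _ = X]/(_ * _) mulrC.
rewrite (lin0 (ev_linr phi)) big1_seq // => p /andP[_ /dbas_homog[_ h]].
by rewrite (linZ (ev_linl a)) (ev_homog h ha) ?scaler0 // opprK eq_sym.
Qed.

Lemma expand (V : lmodType k) (G : int -> A -> V) s i a :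
  (forall i, linear (G i)) -> uniq s -> homog i a ->
  \sum_(j <- s) \sum_(p <- dbas j) ev p.2 a *: G j p.1 = if i \in s then G i a else 0.
Proof.
move=> Gl us ha.
have E j : \sum_(p <- dbas j) ev p.2 a *: G j p.1 = if j == i then G i a else 0.
  case: eqP => [->|/eqP ji].
    rewrite [in RHS](dbas_sum ha) (lin_sum _ _ (Gl i)); apply: eq_bigr => p _.
    by rewrite (linZ (Gl i)).
  rewrite big1_seq // => p /andP[_ /dbas_homog[_ h]].
  by rewrite (ev_homog h ha) ?scale0r // opprK eq_sym.
rewrite (eq_bigr _ (fun j _ => E j)) -big_mkcond /=.
case: (boolP (i \in s)) => is_; last first.
  by rewrite big1_seq // => j /andP[/eqP -> js]; rewrite js in is_.
rewrite -big_filter (_ : [seq j <- s | j == i] = [:: i]) ?big_seq1 //.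
by rewrite filter_pred1_uniq.
Qed.

Lemma exR (V : lmodType k) (F : A -> V) (s : seq int) : linear F ->
  (forall i a, i \notin s -> homog i a -> F a = 0) ->
  exists x : tensor V C, forall a, pairR x a = F a.
Proof.
move=> Fl h.
exists (\sum_(j <- undup s) \sum_(p <- dbas j) ten (F p.1) p.2).
apply: gext => [||i a ha]; [exact: pairR_linr|exact: Fl|].
rewrite (lin_sum _ _ (pairR_lin a)).
transitivity (\sum_(j <- undup s) \sum_(p <- dbas j) ev p.2 a *: F p.1).
  apply: eq_bigr => j _; rewrite (lin_sum _ _ (pairR_lin a)).
  by apply: eq_bigr => p _; rewrite pairRE.
rewrite (expand (fun=> Fl) (undup_uniq s) ha) mem_undup.
by case: (boolP (i \in s)) => // /h ->.
Qed.

Lemma exL (V : lmodType k) (F : A -> V) (s : seq int) : linear F ->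
  (forall i a, i \notin s -> homog i a -> F a = 0) ->
  exists x : tensor C V, forall a, pairL x a = F a.
Proof.
move=> Fl h.
exists (\sum_(j <- undup s) \sum_(p <- dbas j) ten p.2 (F p.1)).
apply: gext => [||i a ha]; [exact: pairL_linr|exact: Fl|].
rewrite (lin_sum _ _ (pairL_lin a)).
transitivity (\sum_(j <- undup s) \sum_(p <- dbas j) ev p.2 a *: F p.1).
  apply: eq_bigr => j _; rewrite (lin_sum _ _ (pairL_lin a)).
  by apply: eq_bigr => p _; rewrite pairLE.
rewrite (expand (fun=> Fl) (undup_uniq s) ha) mem_undup.
by case: (boolP (i \in s)) => // /h ->.
Qed.

Lemma zeroC (phi : C) : (forall i, pr (- i) phi = 0) -> phi = 0.
Proof.
move=> h; apply: dual_eq => i a ha.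
by rewrite -{1}ha -[pr i a]/(pr i a) -[i]opprK -ev_pr h.
Qed.

Lemma sepR (V : lmodType k) (x y : tensor V C) :
  (forall i a, homog i a -> pairR x a = pairR y a) -> x = y.
Proof.
move=> h; apply/eqP; rewrite -subr_eq0; apply/eqP.
have {h} : forall i a, homog i a -> pairR (x - y) a = 0.
  by move=> i a ha; rewrite (linB (pairR_lin a)) (h i) // subrr.
move: (x - y) => {x y} x hx.
have E i (z : tensor V C) :
    tmap id (pr (- i)) z = \sum_(p <- dbas i) ten (pairR z p.1) p.2.
  move: z; apply: ten_ext => [||v phi].
  - by apply: tmap_lin => //; exact: prl.
  - apply: lin_bigsum => p; exact: (lin_comp (ten_linl p.2) (pairR_lin p.1)).
  rewrite tmapE //; last exact: prl.
  rewrite dbas_dual (lin_sum _ _ (ten_linr v)); apply: eq_bigr => p _.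
  by rewrite pairRE (linZ (ten_linr v)) (linZ (ten_linl _)).
have fin (z : tensor V C) : exists s : seq int, forall t, uniq t -> {subset s <= t} ->
    z = \sum_(i <- t) tmap id (pr i) z.
  have tl i : linear (tmap (@id V) (@pr _ C i)) by apply: tmap_lin => //; exact: prl.
  elim/ten_ind: z => [|z1 z2 [s1 h1] [s2 h2]|v phi].
  - by exists [::] => t _ _; rewrite big1 // => i _; rewrite (lin0 (tl i)).
  - exists (s1 ++ s2) => t ut st.
    have E1 : z1 = \sum_(i <- t) tmap id (pr i) z1.
      by apply: h1 => // i hi; apply: st; rewrite mem_cat hi.
    have E2 : z2 = \sum_(i <- t) tmap id (pr i) z2.
      by apply: h2 => // i hi; apply: st; rewrite mem_cat hi orbT.
    rewrite [LHS](congr2 +%R E1 E2) -big_split /=.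
    by apply: eq_bigr => i _; rewrite (linD (tl i)).
  exists (supp phi) => t ut st.
  rewrite {1}(covers_sum (covers_sub (suppP phi) ut st)) (lin_sum _ _ (ten_linr v)).
  by apply: eq_bigr => i _; rewrite tmapE //; exact: prl.
have [s hs] := fin x; rewrite (hs (undup s) (undup_uniq s)); last first.
  by move=> i; rewrite mem_undup.
rewrite big1 // => i _; rewrite -[i]opprK E big1_seq // => p /andP[_ /dbas_homog[hp _]].
by rewrite (hx _ _ hp) (lin0 (ten_linl _)).
Qed.

Lemma tswap_bilin (V W : lmodType k) : bilin (fun (v : V) (w : W) => ten w v).
Proof. by have [h1 h2] := ten_bilin W V. Qed.

Lemma sepL (V : lmodType k) (x y : tensor C V) :
  (forall i a, homog i a -> pairL x a = pairL y a) -> x = y.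
Proof.
pose sw (U W : lmodType k) : tensor U W -> tensor W U := tlift (fun v w => ten w v).
have swl U W : linear (sw U W) by exact: tlift_lin (tswap_bilin U W).
have swE U W u w : sw U W (ten u w) = ten w u by rewrite /sw tliftE //; exact: tswap_bilin.
have swK z : sw _ _ (sw C V z) = z.
  move: z; apply: ten_ext => [||u w]; [exact: (lin_comp (swl _ _) (swl _ _))|by []|by rewrite !swE].
have swP z a : pairR (sw C V z) a = pairL z a.
  move: z; apply: ten_ext => [||u w]; first exact: (lin_comp (pairR_lin a) (swl _ _)).
    exact: pairL_lin.
  by rewrite swE pairRE pairLE.
move=> h; rewrite -[x]swK -[y]swK; congr (sw _ _ _); apply: sepR => i a ha.
by rewrite !swP (h i).
Qed.

Lemma sep2 (x y : tensor C C) : (forall i j a b, homog i a -> homog j b ->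
  pair2 x a b = pair2 y a b) -> x = y.
Proof.
move=> h; apply: sepR => j b hb; apply: dual_eq => i a ha.
by rewrite !ev_pairR (h i j).
Qed.

Definition pairR2 (V : lmodType k) (x : tensor V (tensor C C)) (a b : A) : V :=
  tlift (fun v y => pair2 y a b *: v) x.

Lemma pairR2_bilin (V : lmodType k) a b :
  bilin (fun (v : V) (y : tensor C C) => pair2 y a b *: v).
Proof.
split=> [y|v]; first exact: lin_scale.
exact: (lin_comp (scale_lin v) (pair2_lin a b)).
Qed.
Lemma pairR2E (V : lmodType k) (v : V) y a b : pairR2 (ten v y) a b = pair2 y a b *: v.
Proof. by rewrite /pairR2 tliftE //; exact: pairR2_bilin. Qed.
Lemma pairR2_lin (V : lmodType k) a b : linear (fun x : tensor V (tensor C C) => pairR2 x a b).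
Proof. exact: tlift_lin (pairR2_bilin V a b). Qed.

Lemma pairR2_assoc (V : lmodType k) (x : tensor (tensor V C) C) a b :
  pairR2 (tassoc x) a b = pairR (pairR x b) a.
Proof.
move: x; apply: ten_ext3 => [||v phi psi].
- exact: (lin_comp (pairR2_lin a b) (@tassoc_lin _ _ _ _)).
- exact: (lin_comp (pairR_lin a) (pairR_lin b)).
by rewrite tassocE pairR2E pair2E pairRE (linZ (pairR_lin a)) pairRE scalerA mulrC.
Qed.

Lemma tassoc_surj (U V W : lmodType k) (x : tensor U (tensor V W)) :
  exists y, tassoc y = x.
Proof.
elim/ten_ind: x => [|x y [x' <-] [y' <-]|u x].
- by exists 0; rewrite (lin0 (@tassoc_lin _ _ _ _)).
- by exists (x' + y'); rewrite (linD (@tassoc_lin _ _ _ _)).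
elim/ten_ind: x => [|x y [x' hx] [y' hy]|v w].
- by exists 0; rewrite (lin0 (@tassoc_lin _ _ _ _)) (lin0 (ten_linr u)).
- by exists (x' + y'); rewrite (linD (@tassoc_lin _ _ _ _)) hx hy (linD (ten_linr u)).
- by exists (ten (ten u v) w); rewrite tassocE.
Qed.

Lemma sepR2 (V : lmodType k) (x y : tensor V (tensor C C)) :
  (forall i j a b, homog i a -> homog j b -> pairR2 x a b = pairR2 y a b) -> x = y.
Proof.
have [x' <-] := tassoc_surj x; have [y' <-] := tassoc_surj y => h; congr tassoc.
apply: sepR => j b hb; apply: sepR => i a ha; rewrite -!pairR2_assoc; exact: h ha hb.
Qed.

Lemma sepL2 (V : lmodType k) (x y : tensor C (tensor C V)) :
  (forall i j a b, homog i a -> homog j b ->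
     pairL (pairL x a) b = pairL (pairL y a) b) -> x = y.
Proof.
by move=> h; apply: sepL => i a ha; apply: sepL => j b hb; apply: h ha hb.
Qed.

End DualBasis.

Section DualCoalgebra.
Variables (k : fieldType) (A : dgalg k).
Local Notation C := (dual_dg A).

(* C \ox C is embedded in the dual of A \ox A by
   (phi \ox psi)(a \ox b) = (-1)^(|psi| |a|) phi(a) psi(b), which is
   (-1)^(|a| |b|) phi(a) psi(b) as only |psi| = - |b| contributes. The coproduct
   of phi is the element (unique by sep2, existing by dual_comulP) with
   image a \ox b |-> phi(a b). *)
Definition dual_comul_spec (phi : C) (x : tensor_dg C C) := forall i j a b,
  homog i a -> homog j b -> (-1) ^ (i * j) * pair2 x a b = ev phi (amul a b).

Definition dual_comul (phi : C) : tensor_dg C C := xget 0 (dual_comul_spec phi).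

Lemma one_d : dif (aone A) = 0.
Proof.
have P := dgalgP A; have := mul_leibniz P (aone A) (one_deg P).
rewrite (mul_1l P) (mul_1r P) expr0z scale1r (mul_1l P) => /eqP.
by rewrite -subr_eq0 opprD addrA subrr sub0r oppr_eq0 => /eqP.
Qed.

Variable ftA : finite_type A.

Lemma dual_comulP phi : dual_comul_spec phi (dual_comul phi).
Proof.
rewrite /dual_comul; case: xgetP => [x _ //|none].
have P := dgalgP A; have [mb1 mb2] := mul_bilin P.
pose s := supp phi.
pose I : seq int := [seq Posz n | n <- iota 0 (\max_(p <- s) `|p|%N).+1].
have uI : uniq I by rewrite map_inj_uniq ?iota_uniq // => m n [].
have van i j a b : homog i a -> homog j b -> (i \notin I) || (j \notin I) ->
    ev phi (amul a b) = 0.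
  move=> ha hb ij.
  case: i ha ij => [i|i] ha ij; last first.
    by rewrite (alg_nonneg P _ ha) // (lin0 (mb1 b)) (lin0 (ev_linr phi)).
  case: j hb ij => [j|j] hb ij; last first.
    by rewrite (alg_nonneg P _ hb) // (lin0 (mb2 a)) (lin0 (ev_linr phi)).
  have hab := mul_deg P ha hb; rewrite -hab.
  have -> : (i%:Z + j%:Z)%R = - - (i%:Z + j%:Z)%R by rewrite opprK.
  rewrite -ev_pr (suppP phi).2 ?(lin0 (ev_linl _)) //.
  apply/negP => /= sij; move: ij; apply/negP; rewrite negb_or !negbK.
  have le : (i + j <= \max_(p <- s) `|p|)%N.
    have -> : (i + j = `|- (i%:Z + j%:Z)%R|)%N by rewrite abszN.
    by apply: (@leq_bigmax_seq _ s xpredT (fun p : int => `|p|%N)).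
  by apply/andP; split; apply/mapP; [exists i|exists j] => //;
    rewrite mem_iota /= add0n ltnS; apply: leq_trans le; rewrite ?leq_addr ?leq_addl.
pose G i j a b : k^o := (-1) ^ (i * j) * ev phi (amul a b).
have G1 i j b : linear (fun a => G i j a b).
  by move=> c x y; rewrite /G (mb1 b) (ev_linr phi) mulrDr mulrCA.
have G2 i j a : linear (G i j a).
  by move=> c x y; rewrite /G (mb2 a) (ev_linr phi) mulrDr mulrCA.
pose x : tensor C C := \sum_(i <- I) \sum_(p <- dbas ftA i) \sum_(j <- I)
   \sum_(q <- dbas ftA j) (G i j p.1 q.1 : k) *: ten p.2 q.2.
case: (none x) => i0 j0 a b ha hb.
have -> : pair2 x a b = \sum_(i <- I) \sum_(p <- dbas ftA i)
    ev p.2 a *: (\sum_(j <- I) \sum_(q <- dbas ftA j) ev q.2 b *: G i j p.1 q.1).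
  rewrite (lin_sum _ _ (pair2_lin a b)); apply: eq_bigr => i _.
  rewrite (lin_sum _ _ (pair2_lin a b)); apply: eq_bigr => p _.
  rewrite scaler_sumr (lin_sum _ _ (pair2_lin a b)); apply: eq_bigr => j _.
  rewrite scaler_sumr (lin_sum _ _ (pair2_lin a b)); apply: eq_bigr => q _.
  rewrite (linZ (pair2_lin a b)) pair2E -![_ *: _]/(_ * _); ring.
rewrite (expand ftA (G := fun i a => \sum_(j <- I) \sum_(q <- dbas ftA j) ev q.2 b *: G i j a q.1) _ uI ha).
  rewrite (expand ftA (G := fun j b => G i0 j a b) _ uI hb) //.
  case: (boolP (i0 \in I)) => hi; last by rewrite mulr0 (van _ _ _ _ ha hb) ?hi.
  case: (boolP (j0 \in I)) => hj; last by rewrite mulr0 (van _ _ _ _ ha hb) ?hj ?orbT.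
  by rewrite /G mulrA sign_sq mul1r.
move=> i; apply: lin_bigsum => j; apply: lin_bigsum => q.
exact: lin_scale (G1 _ _ _).
Qed.

Lemma dual_comulE phi i j a b : homog i a -> homog j b ->
  pair2 (dual_comul phi) a b = (-1) ^ (i * j) * ev phi (amul a b).
Proof. by move=> ha hb; rewrite -(dual_comulP _ ha hb) mulrA sign_sq mul1r. Qed.

Lemma dual_comul_lin : linear dual_comul.
Proof.
move=> c f g; apply: (sep2 ftA) => i j a b ha hb.
rewrite (pair2_lin a b) !(dual_comulE _ ha hb) (ev_linl (amul a b)) mulrDr.
by rewrite -![_ *: _]/(_ * _) mulrCA.
Qed.

Lemma dual_comul_dg : dgmor dual_comul.
Proof.
have P := dgalgP A.
apply: dgmor_ext; first exact: dual_comul_lin.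
- move=> n f hf; apply: (sep2 ftA) => i j a b ha hb.
  rewrite (pair2_pr _ _ ha hb) (dual_comulE _ ha hb).
  case: eqP => // nij; rewrite (ev_homog hf (mul_deg P ha hb)) ?mulr0 //.
  by apply/eqP => e; apply: nij; rewrite e opprK.
- move=> n f hf; apply: (sep2 ftA) => i j a b ha hb.
  rewrite (pair2_dif _ ha hb) (dual_comulE _ ha hb) (dual_comulE _ (dif_homog ha) hb).
  rewrite (dual_comulE _ ha (dif_homog hb)) (ev_dif _ (mul_deg P ha hb)).
  rewrite (mul_leibniz P _ ha) (linD (ev_linr f)) (linZ (ev_linr f)) -[_ *: _]/(_ * _).
  have -> : (-1) ^ ((i + 1) * j) = (-1) ^ (i * j) * (-1) ^ j :> k.
    by rewrite -signD; congr (_ ^ _); ring.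
  have -> : (-1) ^ (i * (j + 1)) = (-1) ^ (i * j) * (-1) ^ i :> k.
    by rewrite -signD; congr (_ ^ _); ring.
  by rewrite !signD; ring.
Qed.

Lemma dual_counit_dg : dgmor (@dual_counit k A).
Proof.
have P := dgalgP A.
split=> [|n f|f].
- exact: (ev_linl (aone A)).
- rewrite /dual_counit ev_pr (pr_homog _ (one_deg P)) /= /unit_pr oppr_eq0.
  by case: eqP => // _; rewrite (lin0 (ev_linr f)).
- by rewrite /dual_counit (ev_dif _ (one_deg P)) one_d (lin0 (ev_linr f)) mulr0.
Qed.

Lemma pairR2_map (V : lmodType k) (x : tensor V C) i j a b : homog i a -> homog j b ->
  pairR2 (tmap id dual_comul x) a b = (-1) ^ (i * j) *: pairR x (amul a b).
Proof.
move=> ha hb; have tl : linear (tmap (@id V) dual_comul).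
  by apply: tmap_lin => //; exact: dual_comul_lin.
move: x; apply: ten_ext => [||v phi].
- exact: (lin_comp (pairR2_lin a b) tl).
- by apply: lin_scale; exact: pairR_lin.
rewrite tmapE //; last exact: dual_comul_lin.
by rewrite pairR2E (dual_comulE _ ha hb) pairRE scalerA.
Qed.

Lemma dual_coalgP : dgcoalg_axioms dual_comul (@dual_counit k A).
Proof.
have P := dgalgP A.
split.
- exact: dual_comul_dg.
- exact: dual_counit_dg.
- move=> phi; apply: (sepR2 ftA) => j l b c hb hc; apply: dual_eq => i a ha.
  rewrite pairR2_assoc (pairR2_map _ hb hc) (pairR_map _ _ dual_comul_lin) ev_pairR.
  rewrite (dual_comulE _ ha hb) (linZ (ev_linl a)) !ev_pairR -[_ *: _]/(_ * _).
  rewrite (dual_comulE _ ha (mul_deg P hb hc)) (dual_comulE _ (mul_deg P ha hb) hc).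
  rewrite (mul_assoc P) !mulrA -!signD; congr (_ ^ _ * _); ring.
- move=> phi; apply: dual_eq => i a ha.
  rewrite -[tlift _ _]/(pairL (dual_comul phi) (aone A)) ev_pairL.
  by rewrite (dual_comulE _ (one_deg P) ha) mul0r expr0z mul1r (mul_1l P).
- move=> phi; apply: dual_eq => i a ha.
  rewrite -[tlift _ _]/(pairR (dual_comul phi) (aone A)) ev_pairR.
  by rewrite (dual_comulE _ ha (one_deg P)) mulr0 expr0z mul1r (mul_1r P).
- move=> n phi n0 hphi; apply: dual_eq => i a ha; rewrite (lin0 (ev_linl a)).
  have [e|ne] := eqVneq i (- n); last by rewrite (ev_homog hphi ha ne).
  by rewrite (alg_nonneg P _ ha) ?(lin0 (ev_linr phi)) // e oppr_lt0.
Qed.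

Definition dual : dgcoalg k := DGCoalg dual_coalgP.

Section RightComodule.
Variable M : dglmod A.
Let LP := dglmodP M.

(* M \ox C is embedded in Hom(A, M) by (m \ox phi)(a) = phi(a) m. The coaction
   sends m to the element (unique by sepR, existing by rcoact_specP) with image
   a |-> (-1)^(|a| |m|) a m; this is a |-> a m with the Koszul sign for the
   exchange of m and a, without which the coaction is not a chain map. *)
Definition rcoact_spec (m : M) (x : tensor_dg M C) := forall i a,
  homog i a -> pairR x a = lact a (ksign i m).
Definition lmod_coact (m : M) : tensor_dg M C := xget 0 (rcoact_spec m).

Hypothesis lfM : llocally_finite M.

Lemma lgen_support (m : M) : exists s : seq int,
  forall v, lgenerated m v -> forall n, n \notin s -> pr n v = 0.
Proof.
have [e he] := lfM m; exists (flatten [seq supp v | v <- e]) => v /he[c ->] n nn.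
rewrite (lin_sum _ _ (prl n)) big1 // => i _; rewrite (linZ (prl n)) (suppP _).2 ?scaler0 //.
apply: contra nn => h; apply/flattenP; exists (supp e`_i) => //.
by apply/mapP; exists e`_i => //; apply: mem_nth.
Qed.

Lemma rcoact_specP m : rcoact_spec m (lmod_coact m).
Proof.
rewrite /lmod_coact; case: xgetP => [x _ //|none].
pose F := glue (fun i a => lact a (ksign i m)) : A -> M.
have Fl i : linear (fun a : A => lact a (ksign i m)) by exact: (lact_bilin LP).1.
have FE i a : homog i a -> F a = lact a (ksign i m) by move=> ha; rewrite /F (glueE Fl ha).
have [s hs] := lgen_support m.
have [x hx] : exists x : tensor M C, forall a, pairR x a = F a.
  apply: (exR ftA (s := [seq t - j | t <- s, j <- supp m])); first exact: glue_lin.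
  move=> i a ni ha; rewrite (FE _ _ ha).
  rewrite (covers_sum (suppP m)) (lin_sum _ _ (ksign_lin i)).
  rewrite (lin_sum _ _ ((lact_bilin LP).2 a)) big1_seq // => j /andP[_ js].
  rewrite (ksignE i (homog_pr j m)) (linZ ((lact_bilin LP).2 a)).
  rewrite -(lact_deg LP ha (homog_pr j m)) hs ?scaler0 //.
    by move=> S hS hpr ha' hm; apply: ha'; apply: hpr.
  apply: contra ni => ij; apply/allpairsP; exists (i + j, j); split=> //=.
  by rewrite addrK.
by case: (none x) => i a ha; rewrite hx (FE _ _ ha).
Qed.

Lemma lmod_coact_lin : linear lmod_coact.
Proof.
move=> c m m'; apply: (sepR ftA) => i a ha.
by rewrite (pairR_lin a) !(rcoact_specP _ ha) (ksign_lin i) ((lact_bilin LP).2 a).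
Qed.

Lemma lmod_coact_dg : dgmor lmod_coact.
Proof.
apply: dgmor_ext; first exact: lmod_coact_lin.
- move=> n m hm; apply: (sepR ftA) => i a ha.
  rewrite (pairR_pr _ _ ha) (rcoact_specP _ ha) addrC.
  exact: lact_deg LP _ _ _ _ ha (homog_ksign i hm).
- move=> n m hm; have hR : homog n (lmod_coact m).
    apply: (sepR ftA) => i a ha; rewrite (pairR_pr _ _ ha) (rcoact_specP _ ha) addrC.
    exact: lact_deg LP _ _ _ _ ha (homog_ksign i hm).
  apply: (sepR ftA) => i a ha; rewrite (pairR_dif _ ha) (ksignE 1 hR).
  rewrite (linZ (pairR_lin _)) !(rcoact_specP _ ha) (rcoact_specP _ (dif_homog ha)).
  rewrite (lact_leibniz LP _ ha) !(ksignE _ hm) (ksignE _ (dif_homog hm)).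
  rewrite (linZ difl) !(linZ ((lact_bilin LP).2 _)) !scalerA -!signD addrAC.
  rewrite (_ : (-1) ^ (1 * n + (i + 1) * n) = (-1) ^ (i * n)); last first.
    by apply: (@sign_eq _ n); ring.
  rewrite subrr add0r; congr (_ ^ _ *: _); ring.
Qed.

Lemma ksign_lact i j (a : A) (m : M) : homog i a ->
  ksign j (lact a m) = (-1) ^ (j * i) *: lact a (ksign j m).
Proof.
move=> ha; have al := (lact_bilin LP).2 a; move: m; apply: gext => [||n m hm].
- exact: lin_comp (ksign_lin j) al.
- by apply: lin_scale; exact: lin_comp al (ksign_lin j).
rewrite (ksignE j hm) (ksignE j (lact_deg LP ha hm)) (linZ al) scalerA -signD.
by congr (_ ^ _ *: _); ring.
Qed.

Lemma lmod_comodP : @rcomod_axioms k dual M lmod_coact.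
Proof.
split; first exact: lmod_coact_dg.
- move=> m; apply: (sepR2 ftA) => j l b c hb hc.
  rewrite pairR2_assoc (pairR2_map _ hb hc) (pairR_map _ _ lmod_coact_lin).
  rewrite (rcoact_specP _ hb) (rcoact_specP _ hc) (rcoact_specP _ (mul_deg (dgalgP A) hb hc)).
  rewrite (ksign_lact _ _ hc) ksignM (linZ ((lact_bilin LP).2 b)) (lactA LP).
  by [].
- move=> m; rewrite -[tlift _ _]/(pairR (lmod_coact m) (aone A)).
  by rewrite (rcoact_specP _ (one_deg (dgalgP A))) ksign0 (lact1 LP).
Qed.

Definition rcomod_of_lmod : dgrcomod dual := DGRComod lmod_comodP.

End RightComodule.

Section LeftComodule.
Variable N : dgrmod A.
Let RP := dgrmodP N.

(* C \ox N is embedded in Hom(A, N) by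
   (phi \ox n)(a) = (-1)^(|a| |n|) phi(a) n (the argument a moves past n), and the
   coaction sends n to the element with image a |-> n a, with no sign since n and
   a are not exchanged. *)
Definition lcoact_spec (n : N) (x : tensor_dg C N) := forall i a,
  homog i a -> ksign i (pairL x a) = ract n a.
Definition rmod_coact (n : N) : tensor_dg C N := xget 0 (lcoact_spec n).

Hypothesis lfN : rlocally_finite N.

Lemma rgen_support (m : N) : exists s : seq int,
  forall v, rgenerated m v -> forall n, n \notin s -> pr n v = 0.
Proof.
have [e he] := lfN m; exists (flatten [seq supp v | v <- e]) => v /he[c ->] n nn.
rewrite (lin_sum _ _ (prl n)) big1 // => i _; rewrite (linZ (prl n)) (suppP _).2 ?scaler0 //.
apply: contra nn => h; apply/flattenP; exists (supp e`_i) => //.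
by apply/mapP; exists e`_i => //; apply: mem_nth.
Qed.

Lemma lcoact_specP n : lcoact_spec n (rmod_coact n).
Proof.
rewrite /rmod_coact; case: xgetP => [x _ //|none].
pose F := glue (fun i a => ksign i (ract n a)) : A -> N.
have rl : linear (ract n) by exact: (ract_bilin RP).2.
have Fl i : linear (fun a : A => ksign i (ract n a)).
  exact: lin_comp (ksign_lin i) rl.
have FE i a : homog i a -> F a = ksign i (ract n a) by move=> ha; rewrite /F (glueE Fl ha).
have [s hs] := rgen_support n.
have [x hx] : exists x : tensor C N, forall a, pairL x a = F a.
  apply: (exL ftA (s := [seq t - j | t <- s, j <- supp n])); first exact: glue_lin.
  move=> i a ni ha; rewrite (FE _ _ ha).
  suff -> : ract n a = 0 by rewrite (lin0 (ksign_lin i)).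
  rewrite (covers_sum (suppP n)).
  rewrite (lin_sum _ _ ((ract_bilin RP).1 a)) big1_seq // => j /andP[_ js].
  rewrite -(ract_deg RP (homog_pr j n) ha) hs //.
    by move=> S hS hpr ha' hm; apply: ha'; apply: hpr.
  apply: contra ni => ij; apply/allpairsP; exists (j + i, j); split=> //=.
  by rewrite addrC addrA addNr add0r.
by case: (none x) => i a ha; rewrite hx (FE _ _ ha) ksignK.
Qed.

Lemma pairL_coact n i a : homog i a -> pairL (rmod_coact n) a = ksign i (ract n a).
Proof. by move=> ha; rewrite -(lcoact_specP n ha) ksignK. Qed.

Lemma rmod_coact_lin : linear rmod_coact.
Proof.
move=> c m m'; apply: (sepL ftA) => i a ha.
by rewrite (pairL_lin a) !(pairL_coact _ ha) ((ract_bilin RP).1 a) (ksign_lin i).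
Qed.

Lemma rmod_coact_dg : dgmor rmod_coact.
Proof.
apply: dgmor_ext; first exact: rmod_coact_lin.
- move=> n m hm; apply: (sepL ftA) => i a ha.
  rewrite (pairL_pr _ _ ha) (pairL_coact _ ha).
  by apply: homog_ksign; exact: ract_deg RP _ _ _ _ hm ha.
- move=> n m hm; apply: (sepL ftA) => i a ha; have dha := dif_homog ha.
  rewrite (pairL_dif _ ha) !(pairL_coact _ ha) (pairL_coact _ dha).
  rewrite dif_ksign (ract_leibniz RP _ hm) (linD (ksign_lin i)) (linZ (ksign_lin i)).
  rewrite (ksignE _ (ract_deg RP hm dha)) (ksignE i (ract_deg RP hm dha)).
  rewrite !scalerDr !scalerA sign_sq scale1r -!signD addrCA -scalerDl.
  rewrite mul1r -signD.
  rewrite (_ : (-1) ^ (i + (i + 1) * (n + (i + 1))) = - (-1) ^ (n + i * (n + (i + 1)))).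
    by rewrite addNr scale0r addr0.
  by rewrite signN; apply: (@sign_eq _ i); ring.
Qed.

Lemma ksign_ract i j (m : N) (a : A) : homog i a ->
  ksign j (ract m a) = (-1) ^ (j * i) *: ract (ksign j m) a.
Proof.
move=> ha; have al := (ract_bilin RP).1 a; move: m; apply: gext => [||n m hm].
- exact: lin_comp (ksign_lin j) al.
- by apply: lin_scale; exact: lin_comp al (ksign_lin j).
rewrite (ksignE j hm) (ksignE j (ract_deg RP hm ha)) (linZ al) scalerA -signD.
by congr (_ ^ _ *: _); ring.
Qed.

Lemma pairL_assoc (V : lmodType k) (x : tensor (tensor C C) V) a b :
  pairL (pairL (tassoc x) a) b = tlift (fun y v => pair2 y a b *: v) x.
Proof.
have bl : bilin (fun (y : tensor C C) (v : V) => pair2 y a b *: v).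
  by have [h1 h2] := pairR2_bilin V a b.
move: x; apply: ten_ext3 => [||phi psi v].
- apply: (lin_comp (pairL_lin b)).
  exact: (lin_comp (pairL_lin a) (@tassoc_lin _ _ _ _)).
- exact: tlift_lin.
by rewrite tassocE tliftE // pair2E pairLE (linZ (pairL_lin b)) pairLE scalerA.
Qed.

Lemma rmod_comodP : @lcomod_axioms k dual N rmod_coact.
Proof.
split; first exact: rmod_coact_dg.
- move=> n; apply: (sepL2 ftA) => i j a b ha hb; have hab := mul_deg (dgalgP A) ha hb.
  rewrite (pairL_map _ _ rmod_coact_lin) (pairL_coact _ ha) (pairL_coact _ hb) pairL_assoc.
  transitivity ((-1) ^ (i * j) *: pairL (rmod_coact n) (amul a b)).
    move: (rmod_coact n); apply: ten_ext => [||phi v].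
    - apply: lin_comp; last by apply: tmap_lin => //; exact: dual_comul_lin.
      by apply: tlift_lin; have [h1 h2] := pairR2_bilin N a b.
    - by apply: lin_scale; exact: pairL_lin.
    rewrite tmapE //; last exact: dual_comul_lin.
    rewrite tliftE; last by have [h1 h2] := pairR2_bilin N a b.
    by rewrite pairLE (dual_comulE _ ha hb) scalerA.
  rewrite (pairL_coact _ hab) (ractA RP) addrC -ksignM (ksign_ract _ _ hb).
  by rewrite (linZ (ksign_lin j)) scalerA sign_sq scale1r.
- move=> n; rewrite -[tlift _ _]/(pairL (rmod_coact n) (aone A)).
  by rewrite (pairL_coact _ (one_deg (dgalgP A))) ksign0 (ract1 RP).
Qed.

Definition lcomod_of_rmod : dglcomod dual := DGLComod rmod_comodP.

End LeftComodule.

Section Functoriality.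

Variables (M M' : dglmod A) (hM : llocally_finite M) (hM' : llocally_finite M').
Variable f : lmodmor M M'.
Lemma rcomodmorP m : lmod_coact (f m) = tmap f id (lmod_coact m).
Proof.
apply: (sepR ftA) => i a ha.
rewrite (rcoact_specP hM' _ ha) (pairR_map _ _ (dgmor_lin (lmodmor_dg f))).
by rewrite (rcoact_specP hM _ ha) lmodmor_act (dgmor_ksign _ _ (lmodmor_dg f)).
Qed.
Definition rcomodmor_of : rcomodmor (rcomod_of_lmod hM) (rcomod_of_lmod hM') :=
  @RComodMor _ _ (rcomod_of_lmod hM) (rcomod_of_lmod hM') f (lmodmor_dg f) rcomodmorP.

Variables (N N' : dgrmod A) (hN : rlocally_finite N) (hN' : rlocally_finite N').
Variable g : rmodmor N N'.
Lemma lcomodmorP n : rmod_coact (g n) = tmap id g (rmod_coact n).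
Proof.
apply: (sepL ftA) => i a ha.
rewrite (pairL_coact hN' _ ha) (pairL_map _ _ (dgmor_lin (rmodmor_dg g))).
by rewrite (pairL_coact hN _ ha) (dgmor_ksign _ _ (rmodmor_dg g)) rmodmor_act.
Qed.
Definition lcomodmor_of : lcomodmor (lcomod_of_rmod hN) (lcomod_of_rmod hN') :=
  @LComodMor _ _ (lcomod_of_rmod hN) (lcomod_of_rmod hN') g (rmodmor_dg g) lcomodmorP.

End Functoriality.
End DualCoalgebra.

(* Main.v *)
Require Import Defs.
From mathcomp Require Import all_boot all_order all_algebra.
From mathcomp Require Import ring.
From mathcomp Require Import boolp.

(* Pairing the middle factor of M \ox C \ox N with a in A^i turns the cotensor
   condition on x into a x = (-1)^(i |x|) x a (x graded central), the Koszul signs of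
   the two coactions combining to exactly this one. On the other side, a bimodule
   map f out of A is determined by f(1), which can be any graded central element, and
   f(a) = f(1) a. So the isomorphism is x |-> (a |-> x a), with inverse f |-> f(1);
   both formulas are free of signs. *)

Set Implicit Arguments.
Unset Strict Implicit.
Unset Printing Implicit Defensive.

Import GRing.Theory.
Local Open Scope ring_scope.

(** * Homogeneous projections against the action of a homogeneous element *)

Section ModuleProjections.
Variables (k : fieldType) (A : dgalg k) (M : dgvect k).

Lemma lact_pr (act : A -> M -> M) i p a m : lmod_axioms act -> homog i a ->
  act a (pr p m) = pr (i + p) (act a m).
Proof.
move=> L ha; have al := (lact_bilin L).2 a; move: m; apply: gext => [||j m hm].
- exact: lin_comp al (prl p).
- exact: lin_comp (prl (i + p)) al.
rewrite (pr_homog _ hm) (pr_homog _ (lact_deg L ha hm)) (inj_eq (@addrI _ i)).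
by case: eqP => // _; rewrite (lin0 al).
Qed.

Lemma ract_pr (act : M -> A -> M) i p m a : rmod_axioms act -> homog i a ->
  act (pr p m) a = pr (i + p) (act m a).
Proof.
move=> R ha; have ar := (ract_bilin R).1 a; move: m; apply: gext => [||j m hm].
- exact: lin_comp ar (prl p).
- exact: lin_comp (prl (i + p)) ar.
rewrite (pr_homog _ hm) (pr_homog _ (ract_deg R hm ha)) [i + p]addrC.
by rewrite (inj_eq (@addIr _ i)); case: eqP => // _; rewrite (lin0 ar).
Qed.

End ModuleProjections.

(** * Graded central elements and bimodule maps out of [A] *)

Section Central.
Variables (k : fieldType) (A : dgalg k) (Y : dgbimod A).
Let L := blactP Y.
Let R := bractP Y.

(** Using [ksign] for the sign (-1)^(i |y|) lets the condition cover inhomogeneous y, so that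
    central elements form a linear space. *)
Definition central (y : Y) :=
  forall i a, homog i a -> blact a y = bract (ksign i y) a.

Lemma central_pr p y : central y -> central (pr p y).
Proof.
by move=> hy i a ha; rewrite (lact_pr _ _ L ha) (hy i a ha) -pr_ksign (ract_pr _ _ R ha).
Qed.

(** The degree p component is right multiplication by the degree p part of y, so the finite support
    of y bounds the degrees that occur. *)
Lemma rmul_gradedhom (y : Y) : gradedhom (fun a : A => bract y a).
Proof.
split; first exact: (ract_bilin R).2.
exists (supp y) => p i a py ha.
by rewrite -(ract_pr _ _ R ha) (suppP y).2 // (lin0 ((ract_bilin R).1 a)).
Qed.

Definition rmul (y : Y) : hom_dg (alg_bimod A) Y := mksub _ (rmul_gradedhom y).

Lemma rmul_pr p y : pr p (rmul y) = rmul (pr p y).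
Proof.
apply: hom_eq => i a ha.
by rewrite /= (comp_funE _ (hom_lin (rmul y)) ha) /= (ract_pr _ _ R ha).
Qed.

(** Expanding d(y a) by Leibniz, the term (-1)^|y| y d(a) is exactly what the Hom differential
    subtracts. *)
Lemma rmul_dif y : dif (rmul y) = rmul (dif y).
Proof.
apply: hom_eq => i a ha; rewrite /= /dif_fun /= (ksignE 1 (dif_homog ha)).
move: y; apply: gext => [||p y hy].
- apply: lin_add; first exact: lin_comp difl ((ract_bilin R).1 a).
  by apply: lin_opp; apply: (lin_comp (ksign_lin 1)); exact: (ract_bilin R).1.
- exact: lin_comp ((ract_bilin R).1 a) difl.
rewrite (linZ ((ract_bilin R).2 y)) (linZ (ksign_lin 1)).
rewrite (ksignE 1 (ract_deg R hy (dif_homog ha))) (ract_leibniz R _ hy).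
(* The two [ksign] factors have exponents i + 1 and p + i + 1, whose sum is p modulo 2. *)
rewrite scalerA -signD (_ : (-1) ^ _ = (-1) ^ p) ?addrK //.
by apply: (@sign_eq _ (i + 1)); ring.
Qed.

(** Right linearity is associativity of the action; left linearity follows by moving a past each
    homogeneous part of y in y (a x) = (y a) x. *)
Lemma central_bimod_hom y : central y -> bimod_hom (rmul y).
Proof.
move=> hy p; rewrite rmul_pr; have hp := central_pr p hy.
split=> [i a x ha|x b] /=; last exact: (ractA R).
have e : p * i = i * p by ring.
rewrite e (ractA R) -blactrA (hp i a ha) (ksignE i (homog_pr p y)).
by rewrite !(linZ ((ract_bilin R).1 _)) scalerA sign_sq scale1r.
Qed.

(** Evaluate each component f_p at a = a 1 = 1 a: left linearity gives (-1)^(p i) a f_p(1), right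
    linearity gives f_p(1) a. *)
Lemma bimod_hom_central (f : hom_dg (alg_bimod A) Y) :
  bimod_hom f -> central (incl f (aone A)).
Proof.
move=> hf i a ha; have one := one_deg (dgalgP A).
rewrite (covers_sum (suppP (incl f (aone A)))).
rewrite (lin_sum _ _ ((lact_bilin L).2 a)) (lin_sum _ _ (ksign_lin i)).
rewrite (lin_sum _ _ ((ract_bilin R).1 a)); apply: eq_bigr => p _.
rewrite (ksignE i (homog_pr p _)) (linZ ((ract_bilin R).1 a)).
(* As 1 has degree 0, the degree p part of f(1) comes from f_p. *)
have -> : pr p (incl f (aone A)) = incl (pr p f) (aone A).
  by rewrite /= (comp_funE _ (hom_lin f) one) add0r.
have e : i * p = p * i by ring.
have [/(_ i a (aone A) ha) fa /(_ (aone A) a)] := hf p; rewrite -/(amul _ _).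
move=> /= <-; rewrite (mul_1l (dgalgP A)); move: fa => /=.
by rewrite (mul_1r (dgalgP A)) => ->; rewrite scalerA e sign_sq scale1r.
Qed.

Lemma rmul1 y : incl (rmul y) (aone A) = y.
Proof. exact: ract1 R y. Qed.

Lemma bimod_hom_rmul (f : hom_dg (alg_bimod A) Y) :
  bimod_hom f -> rmul (incl f (aone A)) = f.
Proof.
move=> hf; apply: hom_eq => i a _ /=.
(* [bimod_hom] constrains the components of f, so right linearity is applied to each of them and the
   results are summed. *)
have fE b : incl f b = \sum_(p <- supp f) incl (pr p f) b.
  by rewrite -hom_sumE -(covers_sum (suppP f)).
rewrite !fE (lin_sum _ _ ((ract_bilin R).1 a)); apply: eq_bigr => p _.
by have [_ <-] := hf p; rewrite /= (mul_1l (dgalgP A)).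
Qed.

End Central.

(** * Unsigned contraction of the middle factor of a triple tensor product *)

Section MiddlePairing.
Variables (k : fieldType) (A : dgalg k) (ftA : finite_type A) (V W : lmodType k).
Local Notation C := (dual_dg A).

Definition pairM (z : tensor V (tensor C W)) (a : A) : tensor V W :=
  tmap id (fun y => pairL y a) z.

Lemma pairM_lin a : linear (fun z => pairM z a).
Proof. by apply: tmap_lin => //; exact: pairL_lin. Qed.

Lemma pairME v phi w a : pairM (ten v (ten phi w)) a = ev phi a *: ten v w.
Proof.
rewrite /pairM tmapE //; last exact: pairL_lin.
by rewrite pairLE (linZ (ten_linr v)).
Qed.

Lemma pairM_assoc (y : tensor V C) w a :
  pairM (tassoc (ten y w)) a = ten (pairR y a) w.
Proof.
move: y; apply: ten_ext => [||v phi].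
- apply: (lin_comp (pairM_lin a)).
  by apply: (lin_comp (@tassoc_lin _ _ _ _)); exact: ten_linl.
- exact: lin_comp (ten_linl w) (pairR_lin a).
by rewrite tassocE pairME pairRE (linZ (ten_linl w)).
Qed.

(** Moving [C] to the last position turns [pairM] into [pairR], for which [sepR] gives
    separation. *)
Lemma sepM (z z' : tensor V (tensor C W)) :
  (forall i a, homog i a -> pairM z a = pairM z' a) -> z = z'.
Proof.
pose sw (U U' : lmodType k) : tensor U U' -> tensor U' U := tlift (fun u u' => ten u' u).
have swl U U' : linear (sw U U') by exact: tlift_lin (tswap_bilin U U').
have swE U U' u u' : sw U U' (ten u u') = ten u' u.
  by rewrite /sw tliftE //; exact: tswap_bilin.
have idl (U : lmodType k) : linear (@id U) by [].
have mapE U U' v (y : tensor U U') : tmap (@id V) (sw U U') (ten v y) = ten v (sw U U' y).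
  by rewrite tmapE //; exact: swl.
pose to z : tensor V (tensor W C) := tmap id (sw C W) z.
pose from (x : tensor (tensor V W) C) := tmap id (sw W C) (tassoc x).
have tol : linear to by exact: tmap_lin (idl V) (swl C W).
have froml : linear from.
  exact: lin_comp (tmap_lin (idl V) (swl W C)) (@tassoc_lin _ _ _ _).
have toK x : to (from x) = tassoc x.
  move: x; apply: ten_ext3 => [||v w phi]; first exact: lin_comp.
    exact: tassoc_lin.
  by rewrite /to /from tassocE !mapE !swE.
have to_inj : injective to.
  have toK' y : tmap id (sw W C) (to y) = y.
    move: y; apply: ten_ext3r => [||v phi w]; [|by []|].
      exact: lin_comp (tmap_lin (idl V) (swl W C)) tol.
    by rewrite /to !mapE !swE.
  exact: can_inj toK'.
have fromP x a : pairM (from x) a = pairR x a.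
  move: x; apply: ten_ext3 => [||v w phi].
  - exact: lin_comp (pairM_lin a) froml.
  - exact: pairR_lin.
  by rewrite /from tassocE mapE swE pairME pairRE.
(* Surjectivity of [from] reduces to that of [tassoc], since [to] is injective and [to] after [from]
   is [tassoc]. *)
have surj y : exists x, from x = y.
  by have [x hx] := tassoc_surj (to y); exists x; apply: to_inj; rewrite toK.
have [x <-] := surj z; have [x' <-] := surj z' => h.
by congr from; apply: (sepR ftA) => i a ha; rewrite -!fromP (h i).
Qed.

End MiddlePairing.

(** * The cotensor product as the space of central elements *)

Section CotensorCentral.
Variables (k : fieldType) (A : dgalg k) (ftA : finite_type A).
Variables (M : dglmod A) (N : dgrmod A).
Variables (hM : llocally_finite M) (hN : rlocally_finite N).
Local Notation T := (tensor_bimod M N).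
Local Notation Mc := (rcomod_of_lmod ftA hM).
Local Notation Nc := (lcomod_of_rmod ftA hN).

Let al := fun a => (lact_bilin (dglmodP M)).2 a.

(* Multiplying by (-1)^(i |m|) on the left tensor factor makes the signs of both
   coactions depend on total degrees only. *)
Let sg i (x : T) : T := tmap (ksign i) id x.

Let sg_lin i : linear (sg i).
Proof. by apply: tmap_lin => //; exact: ksign_lin. Qed.

Let sgK i : involutive (sg i).
Proof.
move=> x; rewrite /sg tmap_comp //; try exact: ksign_lin.
by rewrite -[RHS]tmap_id; congr (tmap _ _ x); apply: funext => m; rewrite ksignK.
Qed.

(** On m of degree p the coaction contributes (-1)^(i p) and [sg] contributes (-1)^(i (i + p)),
    leaving (-1)^(i i). *)
Lemma sg_rcoact i a (x : T) : homog i a ->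
  sg i (pairM (tassoc (tmap (@rcoact _ _ Mc) id x)) a) = (-1) ^ (i * i) *: blact a x.
Proof.
move=> ha; have rl := dgmor_lin (rcoact_dg (dgrcomodP Mc)).
have tl : linear (tmap (@rcoact _ _ Mc) (@id N)) by exact: tmap_lin.
move: x; apply: tgext => [||p q m n hm hn].
- apply: (lin_comp (sg_lin i)); apply: (lin_comp (pairM_lin a)).
  by apply: lin_comp tl; exact: tassoc_lin.
- by apply: lin_scale; exact: tlact_linr.
rewrite tmapE // pairM_assoc /= (rcoact_specP ftA hM _ ha) tlactE.
rewrite (ksignE i hm) (linZ (al a)) (linZ (ten_linl n)) (linZ (sg_lin i)).
rewrite /sg tmapE //; last exact: ksign_lin.
rewrite (ksignE i (lact_deg (dglmodP M) ha hm)) (linZ (ten_linl n)) scalerA -signD.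
by congr (_ *: _); apply: (@sign_eq _ (i * p)); ring.
Qed.

(** On m and n of degrees p and q the signs are (-1)^(i p) from [sg] and (-1)^(i (q + i)) from the
    coaction: the sign of moving a past all of x, times the same (-1)^(i i) as for the other
    coaction. *)
Lemma sg_lcoact i a (x : T) : homog i a ->
  sg i (pairM (tmap id (@lcoact _ _ Nc) x) a) =
  (-1) ^ (i * i) *: bract (ksign i x) a.
Proof.
move=> ha; have ll := dgmor_lin (lcoact_dg (dglcomodP Nc)).
have tl : linear (tmap (@id M) (@lcoact _ _ Nc)) by exact: tmap_lin.
move: x; apply: tgext => [||p q m n hm hn].
- by apply: (lin_comp (sg_lin i)); apply: (lin_comp (pairM_lin a)).
- apply: lin_scale; apply: (lin_comp (tract_linl a)).
  exact: (@ksign_lin _ (tensor_dg M N)).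
rewrite tmapE // /pairM tmapE //; last exact: pairL_lin.
rewrite /= (pairL_coact ftA hN _ ha) (@ksignE _ T i _ _ (homog_ten hm hn)).
rewrite (ksignE i (ract_deg (dgrmodP N) hn ha)) (linZ (ten_linr m)).
rewrite (linZ (sg_lin i)) (linZ (tract_linl a)) tractE.
rewrite /sg tmapE //; last exact: ksign_lin.
rewrite (ksignE i hm) (linZ (ten_linl _)) !scalerA -!signD.
by congr (_ ^ _ *: _); ring.
Qed.

(** After pairing with a and applying the bijection [sg i], the two coactions share the invertible
    factor (-1)^(i i); [sepM] recovers the cotensor equation from its pairings. *)
Lemma cotensor_condP (x : T) : @cotensor_cond _ _ Mc Nc x <-> central x.
Proof.
split=> [/subr0_eq h i a ha|h].
  apply: (scalerI (a := (-1) ^ (i * i))).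
    by rewrite expfz_neq0 // oppr_eq0 oner_eq0.
  by rewrite -sg_rcoact // h sg_lcoact.
apply/eqP; rewrite subr_eq0; apply/eqP; apply: (sepM ftA) => i a ha.
by apply: (can_inj (sgK i)); rewrite sg_rcoact // sg_lcoact // (h i a ha).
Qed.

Definition cotensor_hom (x : cotensor Mc Nc) : homAe (alg_bimod A) T :=
  mksub _ (central_bimod_hom ((cotensor_condP _).1 (inclE x))).

Lemma cotensor_hom_dgiso : dgiso cotensor_hom.
Proof.
split.
  split=> [c x y|p x|x]; apply: incl_inj.
  - apply: hom_eq => i a _; rewrite incl_lin.
    transitivity (tract (c *: incl x + incl y) a); last exact: (tract_linl a).
    by rewrite -incl_lin.
  - by rewrite /= -rmul_pr.
  - by rewrite /= -rmul_dif.
exists (fun f => mksub _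
  ((cotensor_condP _).2 (bimod_hom_central (inclE f)))) => [x|f]; apply: incl_inj.
  exact: (@rmul1 _ _ T).
exact: bimod_hom_rmul (inclE f).
Qed.

End CotensorCentral.

Theorem proposition6p2 (k : fieldType) (A : dgalg k) (ftA : finite_type A) :
  exists theta : forall (M : dglmod A) (N : dgrmod A)
      (hM : llocally_finite M) (hN : rlocally_finite N),
      cotensor (rcomod_of_lmod ftA hM) (lcomod_of_rmod ftA hN) ->
      homAe (alg_bimod A) (tensor_bimod M N),
    (forall (M : dglmod A) (N : dgrmod A)
        (hM : llocally_finite M) (hN : rlocally_finite N),
      dgiso (theta M N hM hN)) /\
    (forall (M M' : dglmod A) (N N' : dgrmod A)
        (hM : llocally_finite M) (hM' : llocally_finite M')
        (hN : rlocally_finite N) (hN' : rlocally_finite N')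
        (f : lmodmor M M') (g : rmodmor N N')
        (x : cotensor (rcomod_of_lmod ftA hM) (lcomod_of_rmod ftA hN)),
      theta M' N' hM' hN'
        (cotensor_map (rcomodmor_of ftA hM hM' f) (lcomodmor_of ftA hN hN' g) x) =
      homAe_map (tensor_bimodmor f g) (theta M N hM hN x)).
Proof.
exists (@cotensor_hom k A ftA); split=> [M N hM hN|].
  exact: cotensor_hom_dgiso.
move=> M M' N N' hM hM' hN hN' f g x; apply: incl_inj.
apply: hom_eq => i a _; apply: esym.
(* Naturality at a says that the tensor product of f and g commutes with the right action of a. *)
exact: (tmap_ract f g (incl x) a).
Qed.
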